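(* Let $Q$ be a locally target-finite and right rooted quiver, and let $R$ be a left coherent ring. Then a representation $X$ in $\mathrm{Rep}(Q,R)$ is Ding injective if and only if it is Gorenstein strongly fp-injective, that is, if and only if $X\in\Psi(\mathcal{GI})$.
   Context: $R$ is an associative ring with identity. Modules are left $R$-modules; right $R$-modules are called $R^{\mathrm{op}}$-modules. A quiver $Q=(Q_0,Q_1)$ is a directed graph with vertex set $Q_0$ and arrow set $Q_1$; an arrow $a$ has source $s(a)$ and target $t(a)$. $\mathrm{Rep}(Q,R)$ is the abelian category of representations of $Q$ by $R$-modules, i.e. covariant functors from the (path category of the) quiver $Q$ to $R$-modules, with natural transformations as morphisms; $\mathrm{Hom}_Q$ denotes its Hom groups. $Q^{\mathrm{op}}$ is the quiver with the same vertices and all arrows reversed. $Q$ is locally target-finite if for every vertex $v$ the set of arrows with source $v$ is finite. $Q$ is right rooted if there is no infinite sequence of arrows $\bullet\to\bullet\to\bullet\to\cdots$ in $Q$. For $v\in Q_0$, $\psi_v^X:X(v)\to\prod_{a\in Q_1,\,s(a)=v}X(t(a))$ is the homomorphism whose component at $a$ is $X(a)$. Tensor product: for $X\in\mathrm{Rep}(Q,R)$ and an abelian group $G$, let $\mathrm{Hom}(X,G)\in\mathrm{Rep}(Q^{\mathrm{op}},R^{\mathrm{op}})$ be the representation with $\mathrm{Hom}(X,G)(i)=\mathrm{Hom}_{\mathbb Z}(X(i),G)$ and the induced maps on reversed arrows. The functor $\mathrm{Hom}(X,-):\mathbb{Z}\text{-Mod}\to\mathrm{Rep}(Q^{\mathrm{op}},R^{\mathrm{op}})$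 has a left adjoint, denoted $-\otimes_Q X$. A short exact sequence $\eta$ in $\mathrm{Rep}(Q,R)$ is pure if $S\otimes_Q\eta$ is exact for every $S\in\mathrm{Rep}(Q^{\mathrm{op}},R^{\mathrm{op}})$; a long exact sequence is pure if all the short exact sequences into which it decomposes are pure. A representation $X$ is fp-injective if every short exact sequence $0\to X\to Y\to Z\to 0$ in $\mathrm{Rep}(Q,R)$ is pure. A representation $X$ is strongly fp-injective if there is a pure exact sequence $0\to X\to E^0\to E^1\to\cdots$ in $\mathrm{Rep}(Q,R)$ with every $E^i$ injective. A representation $X$ is Gorenstein strongly fp-injective (respectively, Ding injective) if there is an exact complex $\cdots\to I_1\to I_0\to I_{-1}\xrightarrow{f_{-1}}I_{-2}\to\cdots$ of injective representations with $X=\mathrm{Ker}(f_{-1})$ that remains exact after applying $\mathrm{Hom}_Q(J,-)$ for every strongly fp-injective (respectively, fp-injective) representation $J$. An $R$-module $L$ is strongly fp-injective if $\mathrm{Ext}^n_R(P,L)=0$ for every finitely presented $R$-module $P$ and all $n\ge 1$. $\mathcal{GI}$ is the class of Gorenstein strongly fp-injective $R$-modules: modules $N=\mathrm{Z}_0E$ (kernel of the degree-$0$ differential) for some exact complex $E$ of injective $R$-modules such that $\mathrm{Hom}_R(J,E)$ is exact for every strongly fp-injective $R$-module $J$. $\Psi(\mathcal{GI})$ is the class of $X\in\mathrm{Rep}(Q,R)$ such that for every $v\in Q_0$, $\psi_v^X$ is an epimorphism and both $X(v)$ and $\mathrm{Ker}(\psi_v^X)$ lie in $\mathcal{GI}$.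 *)

(* Defs.v *)
From HB Require Import structures.
From mathcomp Require Import all_boot all_order all_algebra.
From mathcomp Require Import boolp classical_sets functions cardinality.

Set Implicit Arguments.
Unset Strict Implicit.
Unset Printing Implicit Defensive.

Import GRing.Theory.

Local Open Scope ring_scope.
Local Open Scope quotient_scope.

Definition surj (U V : Type) (f : U -> V) := forall y, exists x, f x = y.

(* Exactness at [V] of [U -> V -> W]. *)
Definition exact_at (U V W : zmodType) (f : U -> V) (g : V -> W) :=
  forall y : V, g y = 0 <-> exists x : U, f x = y.

Lemma additive_ext (U V : nmodType) (f g : {additive U -> V}) : f =1 g -> f = g.
Proof.
case: f g => [f [[fP]]] [g [[gP]]] /= /funext fg.
case: g / fg gP => gP.
by rewrite (Prop_irrelevance fP gP).
Qed.

Section Kernel.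
Variables (R : pzRingType) (U V : lmodType R) (f : {linear U -> V}).

Record kermod := Kermod { ker_val :> U; _ : f ker_val == 0 }.

HB.instance Definition _ := [isSub for ker_val].
HB.instance Definition _ := [Choice of kermod by <:].

Fact ker_submod_closed : submod_closed [pred x | f x == 0].
Proof.
split=> [|a x y]; rewrite !inE; first by rewrite linear0.
by move=> /eqP fx /eqP fy; rewrite linearP fx fy scaler0 addr0.
Qed.

HB.instance Definition _ :=
  GRing.SubChoice_isSubLmodule.Build R U [pred x | f x == 0] kermod
    ker_submod_closed.

End Kernel.

Section Product.
Variables (R : pzRingType) (I : Type) (M : I -> lmodType R).

Definition modprod : Type := forall i, M i.

HB.instance Definition _ := gen_eqMixin modprod.
HB.instance Definition _ := gen_choiceMixin modprod.

Let add (f g : modprod) : modprod := fun i => f i + g i.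
Let opp (f : modprod) : modprod := fun i => - f i.
Let zero : modprod := fun i => 0.
Let scale (r : R) (f : modprod) : modprod := fun i => r *: f i.

Let addA : associative add.
Proof. by move=> f g h; apply: functional_extensionality_dep => i; rewrite /add addrA. Qed.
Let addC : commutative add.
Proof. by move=> f g; apply: functional_extensionality_dep => i; rewrite /add addrC. Qed.
Let add0 : left_id zero add.
Proof. by move=> f; apply: functional_extensionality_dep => i; rewrite /add add0r. Qed.
Let addN : left_inverse zero opp add.
Proof. by move=> f; apply: functional_extensionality_dep => i; rewrite /add addNr. Qed.

HB.instance Definition _ := GRing.isZmodule.Build modprod addA addC add0 addN.

Let scaleA (a b : R) (f : modprod) : scale a (scale b f) = scale (a * b) f.
Proof. by apply: functional_extensionality_dep => i; rewrite /scale scalerA. Qed.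
Let scale1 : left_id 1 scale.
Proof. by move=> f; apply: functional_extensionality_dep => i; rewrite /scale scale1r. Qed.
Let scaleDr : right_distributive scale +%R.
Proof. by move=> a f g; apply: functional_extensionality_dep => i; rewrite /scale scalerDr. Qed.
Let scaleDl (f : modprod) : {morph scale^~ f : a b / a + b}.
Proof. by move=> a b; apply: functional_extensionality_dep => i; rewrite /scale scalerDl. Qed.

HB.instance Definition _ :=
  GRing.Zmodule_isLmodule.Build R modprod scaleA scale1 scaleDr scaleDl.

End Product.

Section Modules.
Variable R : pzRingType.
Implicit Types M N P L E J : lmodType R.

Definition fin_generated M :=
  exists (n : nat) (p : {linear 'rV[R]_n -> M}), surj p.

Definition fin_presented M :=
  exists (m n : nat) (q : {linear 'rV[R]_m -> 'rV[R]_n})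
         (p : {linear 'rV[R]_n -> M}), exact_at q p /\ surj p.

(* A left ideal is given up to isomorphism, by an embedding of a left module
   into the regular module [R^o]. *)
Definition left_coherent :=
  forall (I : lmodType R) (i : {linear I -> R^o}),
    injective i -> fin_generated I -> fin_presented I.

Definition injective_mod E :=
  forall (M N : lmodType R) (f : {linear M -> N}) (g : {linear M -> E}),
    injective f -> exists h : {linear N -> E}, forall x, h (f x) = g x.

Definition projective_mod P :=
  forall (M N : lmodType R) (f : {linear M -> N}) (g : {linear P -> N}),
    surj f -> exists h : {linear P -> M}, forall x, f (h x) = g x.

Record proj_resolution P := ProjResolution {
  res_ob :> nat -> lmodType R;
  res_d : forall n, {linear res_ob n.+1 -> res_ob n};
  res_aug : {linear res_ob 0%N -> P};
  res_proj : forall n, projective_mod (res_ob n);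
  res_surj : surj res_aug;
  res_exact0 : exact_at (res_d 0) res_aug;
  res_exact : forall n, exact_at (res_d n.+1) (res_d n)
}.

(* The vanishing of [Ext^n(P, L)], that is, of the [n]-th cohomology of
   [Hom(F, L)] for a projective resolution [F] of [P]. The choice of [F] is
   immaterial. *)
Definition Ext_vanishes (n : nat) P L :=
  forall F : proj_resolution P,
  match n with
  | 0 => forall g : {linear F 0%N -> L},
           (forall x, g (res_d F 0 x) = 0) -> forall x, g x = 0
  | m.+1 => forall g : {linear F m.+1 -> L},
           (forall x, g (res_d F m.+1 x) = 0) ->
           exists h : {linear F m -> L}, forall x, h (res_d F m x) = g x
  end.

Definition strongly_fp_injective_mod L :=
  forall (P : lmodType R) (n : nat),
    fin_presented P -> (1 <= n)%N -> Ext_vanishes n P L.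

(* Exactness of [Hom(J, A) -> Hom(J, B) -> Hom(J, C)]. *)
Definition Hom_exact_mod J (A B C : lmodType R)
    (f : {linear A -> B}) (g : {linear B -> C}) :=
  forall u : {linear J -> B},
    (forall x, g (u x) = 0) <->
    exists w : {linear J -> A}, forall x, f (w x) = u x.

(* Complexes are indexed cohomologically; a homological complex has its
   degree [n] term in degree [- n] here. Every integer is of the form [n + 1],
   so the conditions below cover all the degrees. *)
Definition gorenstein_strongly_fp_injective_mod N :=
  exists (E : int -> lmodType R) (d : forall n, {linear E n -> E (n + 1)}),
  [/\ forall n, injective_mod (E n),
      forall n, exact_at (d n) (d (n + 1)),
      forall J, strongly_fp_injective_mod J ->
        forall n, Hom_exact_mod J (d n) (d (n + 1))
    & exists k : {linear N -> E 0}, injective k /\ exact_at k (d 0)].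

End Modules.

(* The arrows are presented as a family indexed by source and target. *)
Record quiver := Quiver {
  vertex :> Type;
  arrow : vertex -> vertex -> Type
}.

Definition op_quiver (Q : quiver) : quiver :=
  Quiver (fun i j : Q => arrow j i).

Definition arrows_from (Q : quiver) (v : Q) : Type := {w : Q & arrow v w}.

Definition locally_target_finite (Q : quiver) :=
  forall v : Q, finite_set [set: arrows_from v].

Definition right_rooted (Q : quiver) :=
  ~ exists v : nat -> Q, inhabited (forall n, arrow (v n) (v n.+1)).

(* A functor on the path category of [Q] is freely determined by its values on
   the vertices and the arrows. *)
Record rep (Q : quiver) (R : pzRingType) := Rep {
  rep_ob :> Q -> lmodType R;
  rep_map : forall (i j : Q), arrow i j -> {linear rep_ob i -> rep_ob j}
}.

Record rep_hom (Q : quiver) (R : pzRingType) (X Y : rep Q R) := RepHom {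
  hom_at :> forall i, {linear X i -> Y i};
  hom_nat : forall (i j : Q) (a : arrow i j) (x : X i),
    hom_at j (rep_map X a x) = rep_map Y a (hom_at i x)
}.

Section Representations.
Variables (Q : quiver) (R : pzRingType).
Implicit Types X Y Z J E : rep Q R.

(* Kernels and cokernels in [Rep(Q, R)] are computed vertexwise. *)
Definition rep_mono X Y (f : rep_hom X Y) := forall i, injective (f i).

Definition rep_epi X Y (f : rep_hom X Y) := forall i, surj (f i).

Definition rep_exact X Y Z (f : rep_hom X Y) (g : rep_hom Y Z) :=
  forall i, exact_at (f i) (g i).

Definition short_exact X Y Z (f : rep_hom X Y) (g : rep_hom Y Z) :=
  [/\ rep_mono f, rep_exact f g & rep_epi g].

Definition is_kernel X Y Z (k : rep_hom X Y) (f : rep_hom Y Z) :=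
  rep_mono k /\ rep_exact k f.

Definition injective_rep E :=
  forall (X Y : rep Q R) (f : rep_hom X Y) (g : rep_hom X E),
    rep_mono f -> exists h : rep_hom Y E, forall i x, h i (f i x) = g i x.

(* Exactness of [Hom_Q(J, X) -> Hom_Q(J, Y) -> Hom_Q(J, Z)]. *)
Definition Hom_exact J X Y Z (f : rep_hom X Y) (g : rep_hom Y Z) :=
  forall u : rep_hom J Y,
    (forall i x, g i (u i x) = 0) <->
    exists w : rep_hom J X, forall i x, f i (w i x) = u i x.

Definition psi X (v : Q) (x : X v) :
    modprod (fun a : arrows_from v => X (projT1 a)) :=
  fun a => rep_map X (projT2 a) x.

Fact psi_is_linear X (v : Q) : linear (@psi X v).
Proof.
by move=> r x y; apply: functional_extensionality_dep => a; rewrite /psi linearP.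
Qed.

HB.instance Definition _ X (v : Q) :=
  GRing.isLinear.Build R (X v) (modprod (fun a : arrows_from v => X (projT1 a)))
    *:%R (@psi X v) (@psi_is_linear X v).

Definition Psi_GI X :=
  forall v : Q,
  [/\ surj (@psi X v),
      gorenstein_strongly_fp_injective_mod (X v)
    & gorenstein_strongly_fp_injective_mod (kermod (@psi X v))].

End Representations.

(* Right [R]-modules are left modules over the converse ring [R^c]. *)

Section HomMod.
Variables (R : pzRingType) (M : lmodType R) (G : zmodType).

Definition zhom : Type := {additive M -> G}.

HB.instance Definition _ := gen_eqMixin zhom.
HB.instance Definition _ := gen_choiceMixin zhom.

Let add (f g : zhom) : zhom := (f : {additive M -> G}) \+ (g : {additive M -> G}).
Let opp (f : zhom) : zhom := \- (f : {additive M -> G}).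
Let zero : zhom := \0 : M -> G.
Let scale (r : R^c) (f : zhom) : zhom :=
  (f : {additive M -> G}) \o ( *:%R (r : R) : M -> M).

Let addA : associative add.
Proof. by move=> f g h; apply: additive_ext => x /=; rewrite addrA. Qed.
Let addC : commutative add.
Proof. by move=> f g; apply: additive_ext => x /=; rewrite addrC. Qed.
Let add0 : left_id zero add.
Proof. by move=> f; apply: additive_ext => x /=; rewrite add0r. Qed.
Let addN : left_inverse zero opp add.
Proof. by move=> f; apply: additive_ext => x /=; rewrite addNr. Qed.

HB.instance Definition _ := GRing.isZmodule.Build zhom addA addC add0 addN.

Let scaleA (a b : R^c) (f : zhom) : scale a (scale b f) = scale (a * b) f.
Proof. by apply: additive_ext => x /=; rewrite scalerA. Qed.
Let scale1 : left_id 1 scale.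
Proof. by move=> f; apply: additive_ext => x /=; rewrite scale1r. Qed.
Let scaleDr : right_distributive scale +%R.
Proof. by move=> a f g; apply: additive_ext. Qed.
Let scaleDl (f : zhom) : {morph scale^~ f : a b / a + b}.
Proof. by move=> a b; apply: additive_ext => x /=; rewrite scalerDl raddfD. Qed.

HB.instance Definition _ :=
  GRing.Zmodule_isLmodule.Build R^c zhom scaleA scale1 scaleDr scaleDl.

Definition zhom_app (f : zhom) : {additive M -> G} := f.

End HomMod.

Section HomRep.
Variables (Q : quiver) (R : pzRingType) (X : rep Q R) (G : zmodType).

Definition zhom_pre (i j : Q) (a : arrow i j) (f : zhom (X j) G) :
  zhom (X i) G := zhom_app f \o rep_map X a.

Fact zhom_pre_is_linear (i j : Q) (a : arrow i j) : linear (zhom_pre a).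
Proof. by move=> r f g; apply: additive_ext => x /=; rewrite linearZ. Qed.

HB.instance Definition _ (i j : Q) (a : arrow i j) :=
  GRing.isLinear.Build R^c (zhom (X j) G) (zhom (X i) G) *:%R (zhom_pre a)
    (zhom_pre_is_linear a).

Definition hom_rep : rep (op_quiver Q) R^c :=
  @Rep (op_quiver Q) R^c (fun i => zhom (X i) G)
    (fun (i j : Q) (a : arrow j i) => zhom_pre a).

End HomRep.

(* [tensor S X] is presented by generators [s (x) x], with [s : S i] and
   [x : X i], and by relations making it biadditive, [R]-balanced and
   compatible with the arrows. [tensor_adjoint] states that it is the value at
   [S] of the left adjoint of [Hom(X, -)]. *)

Section Tensor.
Variables (Q : quiver) (R : pzRingType).
Variables (S : rep (op_quiver Q) R^c) (X : rep Q R).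

Inductive tens_term : Type :=
| TZero
| TOpp of tens_term
| TAdd of tens_term & tens_term
| TGen (i : Q) of S i & X i.

Inductive tens_eq : tens_term -> tens_term -> Prop :=
| TRefl t : tens_eq t t
| TSym t u : tens_eq t u -> tens_eq u t
| TTrans t u w : tens_eq t u -> tens_eq u w -> tens_eq t w
| TCongOpp t u : tens_eq t u -> tens_eq (TOpp t) (TOpp u)
| TCongAdd t t' u u' :
    tens_eq t t' -> tens_eq u u' -> tens_eq (TAdd t u) (TAdd t' u')
| TAddA t u w : tens_eq (TAdd t (TAdd u w)) (TAdd (TAdd t u) w)
| TAddC t u : tens_eq (TAdd t u) (TAdd u t)
| TAdd0 t : tens_eq (TAdd TZero t) t
| TAddN t : tens_eq (TAdd (TOpp t) t) TZero
| TGenDl i (s s' : S i) (x : X i) :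
    tens_eq (TGen (s + s') x) (TAdd (TGen s x) (TGen s' x))
| TGenDr i (s : S i) (x x' : X i) :
    tens_eq (TGen s (x + x')) (TAdd (TGen s x) (TGen s x'))
| TGenZ i (r : R) (s : S i) (x : X i) :
    tens_eq (TGen ((r : R^c) *: s) x) (TGen s (r *: x))
| TGenMap (i j : Q) (a : arrow i j) (s : S j) (x : X i) :
    tens_eq (@TGen i (@rep_map _ _ S j i a s) x) (@TGen j s (rep_map X a x)).

HB.instance Definition _ := gen_eqMixin tens_term.
HB.instance Definition _ := gen_choiceMixin tens_term.

Definition tens_rel (t u : tens_term) : bool := `[< tens_eq t u >].

Fact tens_rel_equiv : equiv_class_of tens_rel.
Proof.
split=> [t|t u|u t w]; first by apply/asboolP; exact: TRefl.
- by apply/asboolP/asboolP; exact: TSym.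
- by move=> /asboolP tu /asboolP uw; apply/asboolP; exact: TTrans tu uw.
Qed.

Canonical tens_equiv := EquivRelPack tens_rel_equiv.

Definition tensor : Type := {eq_quot tens_equiv}.

HB.instance Definition _ := Choice.on tensor.

Definition tens_class (t : tens_term) : tensor := \pi_({eq_quot tens_equiv}) t.

Lemma tens_classP t u : tens_eq t u <-> tens_class t = tens_class u.
Proof. by split=> [tu|/eqmodP/asboolP //]; apply/eqmodP/asboolP. Qed.

Let trepr (q : tensor) : tens_term := repr (q : {eq_quot tens_equiv}).
Let treprK q : tens_class (trepr q) = q. Proof. exact: reprK. Qed.
Let trepr_class t : tens_eq (trepr (tens_class t)) t.
Proof. by apply/tens_classP; rewrite treprK. Qed.

Lemma tens_ind (P : tensor -> Prop) :
  (forall t, P (tens_class t)) -> forall q, P q.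
Proof. by move=> Pt q; rewrite -[q]treprK. Qed.

Let tadd (p q : tensor) := tens_class (TAdd (trepr p) (trepr q)).
Let topp (q : tensor) := tens_class (TOpp (trepr q)).
Let tzero := tens_class TZero.

Let taddE t u : tadd (tens_class t) (tens_class u) = tens_class (TAdd t u).
Proof. by apply/tens_classP/TCongAdd; exact: trepr_class. Qed.
Let toppE t : topp (tens_class t) = tens_class (TOpp t).
Proof. by apply/tens_classP/TCongOpp; exact: trepr_class. Qed.

Let taddA : associative tadd.
Proof.
elim/tens_ind=> t; elim/tens_ind=> u; elim/tens_ind=> w.
by rewrite !taddE; apply/tens_classP/TAddA.
Qed.
Let taddC : commutative tadd.
Proof.
elim/tens_ind=> t; elim/tens_ind=> u.
by rewrite !taddE; apply/tens_classP/TAddC.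
Qed.
Let tadd0 : left_id tzero tadd.
Proof. by elim/tens_ind=> t; rewrite !taddE; apply/tens_classP/TAdd0. Qed.
Let taddN : left_inverse tzero topp tadd.
Proof.
by elim/tens_ind=> t; rewrite toppE !taddE; apply/tens_classP/TAddN.
Qed.

HB.instance Definition _ :=
  GRing.isZmodule.Build tensor taddA taddC tadd0 taddN.

Definition tgen (i : Q) (s : S i) (x : X i) : tensor := tens_class (TGen s x).

Lemma tens_classD t u : tens_class (TAdd t u) = tens_class t + tens_class u.
Proof. by rewrite -taddE. Qed.
Lemma tens_classN t : tens_class (TOpp t) = - tens_class t.
Proof. by rewrite -toppE. Qed.
Lemma tens_class0 : tens_class TZero = 0.
Proof. by []. Qed.

Lemma tgenDl i (s s' : S i) (x : X i) : tgen (s + s') x = tgen s x + tgen s' x.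
Proof. by rewrite -tens_classD; apply/tens_classP/TGenDl. Qed.
Lemma tgenDr i (s : S i) (x x' : X i) : tgen s (x + x') = tgen s x + tgen s x'.
Proof. by rewrite -tens_classD; apply/tens_classP/TGenDr. Qed.
Lemma tgenZ i (r : R) (s : S i) (x : X i) :
  tgen ((r : R^c) *: s) x = tgen s (r *: x).
Proof. by apply/tens_classP/TGenZ. Qed.
Lemma tgenMap (i j : Q) (a : arrow i j) (s : S j) (x : X i) :
  @tgen i (@rep_map _ _ S j i a s) x = @tgen j s (rep_map X a x).
Proof. by apply/tens_classP/TGenMap. Qed.

Lemma tensor_additive_ext (G : zmodType) (f g : {additive tensor -> G}) :
  (forall i (s : S i) (x : X i), f (tgen s x) = g (tgen s x)) -> f = g.
Proof.
move=> fg; apply: additive_ext; elim/tens_ind; elim=> [|t IH|t IHt u IHu|i s x].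
- by rewrite tens_class0 !raddf0.
- by rewrite tens_classN !raddfN IH.
- by rewrite tens_classD !raddfD IHt IHu.
- exact: fg.
Qed.

Section Lift.
Variables (G : zmodType) (b : rep_hom S (hom_rep X G)).

Fixpoint tens_eval (t : tens_term) : G :=
  match t with
  | TZero => 0
  | TOpp t => - tens_eval t
  | TAdd t u => tens_eval t + tens_eval u
  | TGen i s x => zhom_app (b i s) x
  end.

Lemma tens_eval_eq t u : tens_eq t u -> tens_eval t = tens_eval u.
Proof.
elim=> //= {t u}.
- by move=> t u w _ -> _ ->.
- by move=> t u _ ->.
- by move=> t t' u u' _ -> _ ->.
- by move=> t u w; rewrite addrA.
- by move=> t u; rewrite addrC.
- by move=> t; rewrite add0r.
- by move=> t; rewrite addNr.
- by move=> i s s' x; rewrite linearD.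
- by move=> i s x x'; rewrite raddfD.
- by move=> i r s x; rewrite linearZ.
- by move=> i j a s x; rewrite (hom_nat b).
Qed.

Definition tens_lift (q : tensor) : G := tens_eval (trepr q).

Lemma tens_liftE t : tens_lift (tens_class t) = tens_eval t.
Proof. exact/tens_eval_eq/trepr_class. Qed.

Fact tens_lift_is_additive : zmod_morphism tens_lift.
Proof.
elim/tens_ind=> t; elim/tens_ind=> u.
by rewrite -tens_classN -tens_classD !tens_liftE.
Qed.

HB.instance Definition _ :=
  GRing.isZmodMorphism.Build tensor G tens_lift tens_lift_is_additive.

End Lift.

Fact tgen_is_additive i (s : S i) : zmod_morphism (tgen s).
Proof.
move=> x y; apply: (addIr (tgen s y)).
by rewrite -tgenDr !subrK.
Qed.

HB.instance Definition _ i (s : S i) :=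
  GRing.isZmodMorphism.Build (X i) tensor (tgen s) (tgen_is_additive s).

Definition tunit_at (i : op_quiver Q) (s : S i) : hom_rep X tensor i :=
  @tgen i s : {additive X i -> tensor}.

Fact tunit_at_is_linear i : linear (@tunit_at i).
Proof. by move=> r s s'; apply: additive_ext => x /=; rewrite tgenDl tgenZ. Qed.

HB.instance Definition _ i :=
  GRing.isLinear.Build R^c (S i) (hom_rep X tensor i) *:%R (@tunit_at i)
    (@tunit_at_is_linear i).

Fact tunit_nat (i j : op_quiver Q) (a : arrow i j) (s : S i) :
  tunit_at (rep_map S a s) = rep_map (hom_rep X tensor) a (tunit_at s).
Proof. by apply: additive_ext => x /=; exact: tgenMap. Qed.

Definition tunit : rep_hom S (hom_rep X tensor) :=
  @RepHom _ _ S (hom_rep X tensor) (fun i => @tunit_at i) tunit_nat.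

Theorem tensor_adjoint (G : zmodType) (b : rep_hom S (hom_rep X G)) :
  exists! h : {additive tensor -> G},
    forall i (s : S i) (x : X i), h (zhom_app (tunit i s) x) = zhom_app (b i s) x.
Proof.
exists (tens_lift b); split=> [i s x|h hE]; first exact: tens_liftE.
apply: tensor_additive_ext => i s x.
by rewrite [RHS]hE; exact: tens_liftE.
Qed.

End Tensor.

Section TensorMap.
Variables (Q : quiver) (R : pzRingType) (S : rep (op_quiver Q) R^c).
Variables (X Y : rep Q R) (f : rep_hom X Y).

Definition tgen_map_at (i : op_quiver Q) (s : S i) :
    hom_rep X (tensor S Y) i :=
  (@tgen Q R S Y i s \o f i) : {additive X i -> tensor S Y}.

Fact tgen_map_at_is_linear i : linear (@tgen_map_at i).
Proof.
move=> r s s'; apply: additive_ext => x /=.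
by rewrite tgenDl tgenZ linearZ.
Qed.

HB.instance Definition _ i :=
  GRing.isLinear.Build R^c (S i) (hom_rep X (tensor S Y) i) *:%R
    (@tgen_map_at i) (@tgen_map_at_is_linear i).

Fact tgen_map_nat (i j : op_quiver Q) (a : arrow i j) (s : S i) :
  tgen_map_at (rep_map S a s) = rep_map (hom_rep X (tensor S Y)) a (tgen_map_at s).
Proof.
by apply: additive_ext => x /=; rewrite (hom_nat f); exact: tgenMap.
Qed.

Definition tensor_map : {additive tensor S X -> tensor S Y} :=
  tens_lift (@RepHom _ _ S (hom_rep X (tensor S Y))
                     (fun i => @tgen_map_at i) tgen_map_nat).

Lemma tensor_mapE i (s : S i) (x : X i) :
  tensor_map (tgen s x) = tgen s (f i x).
Proof. exact: tens_liftE. Qed.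

End TensorMap.

Section Purity.
Variables (Q : quiver) (R : pzRingType).
Implicit Types X Y Z : rep Q R.

Definition pure_ses X Y Z (f : rep_hom X Y) (g : rep_hom Y Z) :=
  short_exact f g /\
  forall S : rep (op_quiver Q) R^c,
  [/\ injective (tensor_map S f),
      exact_at (tensor_map S f) (tensor_map S g)
    & surj (tensor_map S g)].

Definition fp_injective_rep X :=
  forall (Y Z : rep Q R) (f : rep_hom X Y) (g : rep_hom Y Z),
    short_exact f g -> pure_ses f g.

(* The sequence [0 -> A 0 -> A 1 -> A 2 -> ...] is exact, and so are the short
   exact sequences [0 -> Ker (d n) -> A n -> Im (d n) -> 0] after tensoring. *)
Definition pure_exact (A : nat -> rep Q R)
    (d : forall n, rep_hom (A n) (A n.+1)) :=
  [/\ rep_mono (d 0%N),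
      forall n, rep_exact (d n) (d n.+1)
    & forall n (K I : rep Q R) (k : rep_hom K (A n)) (p : rep_hom (A n) I)
             (m : rep_hom I (A n.+1)),
        short_exact k p -> rep_mono m -> (forall i x, m i (p i x) = d n i x) ->
        pure_ses k p].

Definition strongly_fp_injective_rep X :=
  exists (E : nat -> rep Q R)
         (e : rep_hom X (E 0%N)) (d : forall n, rep_hom (E n) (E n.+1)),
    (forall n, injective_rep (E n)) /\
    @pure_exact (fun n => if n is m.+1 then E m else X)
      (fun n => if n is m.+1 then d m else e).

(* With [C n] standing for [I_{- n}], the map [d 1] is [f_{-1}]. *)
Definition gorenstein_rep (P : rep Q R -> Prop) X :=
  exists (C : int -> rep Q R) (d : forall n, rep_hom (C n) (C (n + 1))),
  [/\ forall n, injective_rep (C n),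
      forall n, rep_exact (d n) (d (n + 1)),
      forall J, P J -> forall n, Hom_exact J (d n) (d (n + 1))
    & exists k : rep_hom X (C 1), is_kernel k (d 1)].

Definition gorenstein_strongly_fp_injective_rep :=
  gorenstein_rep strongly_fp_injective_rep.

Definition ding_injective_rep := gorenstein_rep fp_injective_rep.

End Purity.

(* Main.v *)
(** A right rooted, locally target-finite quiver has finitely many paths out of
  each vertex, and its representations behave like modules. With
  [cofree M i = prod_(p path from i) M (end of p)], injectivity of [X] amounts to
  surjectivity of all the [psi_v] together with injectivity of their kernels, and
  morphisms can be built vertex by vertex, starting from the sinks.

  [Psi(GI)] implies Ding: a representation with surjective [psi_v] and
  Gorenstein kernels embeds in [cofree E], where [E v] is the first term of a
  complete coresolution of [Ker psi_v], and is dually covered by such a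
  representation; cokernel and kernel are of the same kind, so these sequences
  can be spliced into a complete resolution. It stays exact under [Hom(J, -)] as
  soon as the [J v] are strongly fp-injective, since the obstructions to lifting
  at [v] lie in [Ext^1(J v, Ker psi_v) = 0]. By a character argument and by
  coherence, fp-injective representations [J] have this property.

  Ding implies Gorenstein since strongly fp-injective implies fp-injective.

  Gorenstein implies [Psi(GI)]: for [J] a family of strongly fp-injective modules
  with all arrows acting as zero, [Hom(J, C) = prod_v Hom(J v, Ker psi_v^C)], and
  [0 -> J -> cofree J -> cofree N -> 0] is exact, with [N v] the product of the
  [J w] over the arrows [v -> w]; the last two terms are strongly fp-injective,
  so that [Hom(J v, Ker psi_v^C)] is exact. *)
From Stdlib Require List Eqdep.
From HB Require Import structures.
From mathcomp Require Import all_boot all_algebra.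
From mathcomp Require Import boolp classical_sets cardinality.
From mathcomp Require Import ring_quotient.
Require Import Defs.

Set Implicit Arguments.
Unset Strict Implicit.
Unset Printing Implicit Defensive.

Import GRing.Theory.

Local Open Scope ring_scope.
Local Open Scope quotient_scope.

(** * Linear maps *)

Lemma dep_choice (A : Type) (B : A -> Type) (P : forall a, B a -> Prop) :
  (forall a, exists b, P a b) -> exists f : forall a, B a, forall a, P a (f a).
Proof.
move=> h; exists (fun a => projT1 (cid (h a))) => a.
by case: (cid (h a)).
Qed.

(** Completes data at one vertex to a family over all of them; vertices form an arbitrary type, so
    the comparison is classical. *)
Lemma dfun_update (A : Type) (B : A -> Type) (f : forall a, B a) (a : A)
    (b : B a) : exists g : forall a, B a, g a = b.
Proof.
exists (fun c => match pselect (a = c) with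
  | left e => eq_rect a B b c e | right _ => f c end).
case: pselect => // e; by rewrite (Prop_irrelevance e erefl).
Qed.

Section LinearMaps.
Variable R : pzRingType.
Implicit Types U V W : lmodType R.

Definition mklin U V (f : U -> V) (hf : linear f) : {linear U -> V} :=
  HB.pack f (GRing.isLinear.Build R U V *:%R f hf).

(** Uniqueness turns closure of [G] under linear combinations into linearity of any choice
    function. *)
Lemma linear_choice U V (G : U -> V -> Prop) :
  (forall x, exists y, G x y) ->
  (forall x y y', G x y -> G x y' -> y = y') ->
  (forall a x x' y y', G x y -> G x' y' -> G (a *: x + x') (a *: y + y')) ->
  exists h : {linear U -> V}, forall x, G x (h x).
Proof.
move=> ex un lin; have [h hG] := dep_choice ex.
have hl : linear h by move=> a x y; apply: (un (a *: x + y)) => //; apply: lin.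
by exists (mklin hl).
Qed.

Lemma factor_surj U V W (p : {linear U -> V}) (g : {linear U -> W}) :
  surj p -> (forall x, p x = 0 -> g x = 0) ->
  exists h : {linear V -> W}, forall x, h (p x) = g x.
Proof.
move=> sp pg; have [|v w w'|a v v' w w'|h hG] :=
  @linear_choice V W (fun v w => exists2 u, p u = v & g u = w).
- by move=> v; have [u pu] := sp v; exists (g u), u.
- move=> [u pu <-] [u' pu' <-]; apply/subr0_eq; rewrite -linearB pg //.
  by rewrite linearB pu pu' subrr.
- move=> [u pu <-] [u' pu' <-]; exists (a *: u + u'); first by rewrite linearP pu pu'.
  by rewrite linearP.
exists h => x; have [u pu <-] := hG (p x).
by apply/subr0_eq; rewrite -linearB pg // linearB pu subrr.
Qed.

Lemma factor_inj U V W (i : {linear V -> W}) (g : {linear U -> W}) :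
  injective i -> (forall x, exists y, i y = g x) ->
  exists h : {linear U -> V}, forall x, i (h x) = g x.
Proof.
move=> ii ig; apply: (@linear_choice U V (fun x y => i y = g x)) => //.
- by move=> x y y' e e'; apply: ii; rewrite e e'.
- by move=> a x x' y y' e e'; rewrite !linearP e e'.
Qed.

Lemma inj_ker0 U V (f : {linear U -> V}) :
  (forall x, f x = 0 -> x = 0) -> injective f.
Proof. by move=> h x y e; apply/subr0_eq/h; rewrite linearB e subrr. Qed.

Lemma ker0_inj U V (f : {linear U -> V}) :
  injective f -> forall x, f x = 0 -> x = 0.
Proof. by move=> h x e; apply: h; rewrite e linear0. Qed.

(** The additive quotient by the image of [f], with scalars acting through representatives; by [scE]
    the choice of representative does not matter. *)
Lemma coker_exists U V (f : {linear U -> V}) :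
  exists (C : lmodType R) (p : {linear V -> C}), surj p /\ exact_at f p.
Proof.
pose I := [pred x : V | `[< exists u, f u = x >]].
have Icl : zmod_closed I.
  split=> [|x y]; first by apply/asboolP; exists 0; rewrite linear0.
  move=> /asboolP [u <-] /asboolP [v <-]; apply/asboolP.
  by exists (u - v); rewrite linearB.
pose J : zmodClosed V := HB.pack (I : {pred V}) (GRing.isZmodClosed.Build V I Icl).
pose C := Quotient.quot J.
have piP (x y : V) : (\pi_C x = \pi_C y) <-> (exists u, f u = x - y).
  split=> [/eqP|[u e]]; first by rewrite -Quotient.idealrBE => /asboolP.
  by apply/eqP; rewrite -Quotient.idealrBE; apply/asboolP; exists u.
pose sc (a : R) (q : C) : C := \pi_C (a *: repr q).
have scE a x : sc a (\pi_C x) = \pi_C (a *: x).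
  apply/piP; have /piP [u e] : \pi_C (repr (\pi_C x)) = \pi_C x by rewrite reprK.
  by exists (a *: u); rewrite linearZ /= e scalerBr.
have piD (x y : V) : \pi_C (x + y) = \pi_C x + \pi_C y by rewrite !piE.
have ind (P : C -> Prop) : (forall x, P (\pi_C x)) -> forall q, P q.
  by move=> h q; rewrite -[q]reprK.
have scA (a b : R) q : sc a (sc b q) = sc (a * b) q.
  by elim/ind: q => x; rewrite !scE scalerA.
have sc1 : left_id 1 sc by elim/ind => x; rewrite !scE scale1r.
have scDr : right_distributive sc +%R.
  by move=> a; elim/ind => x; elim/ind => y; rewrite -piD !scE scalerDr piD.
have scDl q : {morph sc^~ q : a b / a + b}.
  by elim/ind: q => x a b; rewrite !scE scalerDl piD.
pose L : lmodType R :=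
  HB.pack C (GRing.Zmodule_isLmodule.Build R C scA sc1 scDr scDl).
have plin : linear (\pi_C : V -> L).
  by move=> a x y; rewrite piD -scE.
exists L, (mklin plin); split=> [q|y]; first by exists (repr q); exact: reprK.
have -> : (mklin plin y = 0) = (\pi_C y = \pi_C 0).
  by congr (_ = _); rewrite /= !piE.
by rewrite piP subr0.
Qed.

(** The image is realised as the quotient of [U] by the kernel of [f]. *)
Lemma image_exists U V (f : {linear U -> V}) :
  exists (I : lmodType R) (p : {linear U -> I}) (m : {linear I -> V}),
  [/\ surj p, injective m & forall x, m (p x) = f x].
Proof.
pose incl : {linear kermod f -> U} := mklin (f := @ker_val R U V f) (fun _ _ _ => erefl).
have [C [p [ps pe]]] := coker_exists incl.
have pf x : p x = 0 -> f x = 0 by move=> /pe [[y fy] <-]; apply/eqP.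
have [m mP] := factor_surj ps pf.
exists C, p, m; split=> //; apply: inj_ker0 => c; have [x <-] := ps c.
by rewrite mP => /eqP fx; apply/pe; exists (Kermod fx).
Qed.

End LinearMaps.

(** * Divisible groups *)

(** Division with remainder by the least positive element; a subgroup without one is zero, which
    gives [k = 0]. *)
Lemma int_subgroup (I : int -> Prop) :
  I 0 -> (forall m n, I m -> I n -> I (m - n)) ->
  exists k : nat, forall n : int, I n <-> (k %| n)%Z.
Proof.
move=> I0 IB.
have IN n : I n -> I (- n) by move=> /(IB _ _ I0); rewrite sub0r.
have ID m n : I m -> I n -> I (m + n).
  by move=> Im /IN In; rewrite -[n]opprK; apply: IB.
have IMn m (n : nat) : I m -> I (m *+ n).
  by move=> Im; elim: n => [//|n IH]; rewrite mulrS; apply: ID.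
have IM m n : I m -> I (m * n).
  move=> Im; case: n => n; first by rewrite -mulrzz; exact: IMn.
  by rewrite NegzE mulrN; apply: IN; rewrite -mulrzz; exact: IMn.
have [ex|nex] := pselect (exists k : nat, (0 < k)%N && `[< I k%:Z >]).
  exists (ex_minn ex); case: ex_minnP => k /andP [k0 /asboolP Ik] kmin n.
  split=> [In|/dvdzP [q ->]]; last by rewrite mulrC; apply: IM.
  have k0z : k%:Z != 0 by rewrite eqz_nat -lt0n.
  have Ir : I (n %% k)%Z by rewrite /modz mulrC; apply: IB => //; apply: IM.
  apply/dvdz_mod0P; have := modz_ge0 n k0z; have : (n %% k)%Z < k%:Z by apply: ltz_pmod.
  case: (n %% k)%Z Ir => // r Ir; rewrite ltz_nat => rk _.
  have [->//|rn0] := eqVneq r 0%N.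
  have := kmin r; rewrite lt0n rn0 /= => /(_ (introT (asboolP _) Ir)).
  by rewrite leqNgt rk.
exists 0%N => n; rewrite dvd0z; split=> [In|/eqP -> //].
apply/eqP; case: n In => [[//|n]|n] In; case: nex; exists n.+1; apply/asboolP => //.
by move/IN: In; rewrite NegzE opprK.
Qed.

Definition divisible (D : zmodType) :=
  forall (d : D) (k : nat), (0 < k)%N -> exists d' : D, d' *+ k = d.

(** Every nonzero cyclic group [int / k] has a nonzero homomorphism to [D]; [k = 0] stands for the
    infinite one. *)
Definition has_torsion (D : zmodType) :=
  forall k : nat, k <> 1%N ->
  exists2 d : D, d <> 0 & forall n : int, (k %| n)%Z -> d *~ n = 0.

(** The group is Q/Z. The class of [1 / k] is killed by [k], and nonzero for [k > 1]; for [k = 0]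
    any nonzero class serves, here that of [1 / 2]. *)
Lemma divisible_torsion_exists :
  exists D : zmodType, divisible D /\ has_torsion D.
Proof.
pose S := [pred x : rat | x \is a Num.int].
have Scl : zmod_closed S by split=> [|x y]; rewrite !inE; [exact: rpred0 | exact: rpredB].
pose I : zmodClosed rat := HB.pack (S : {pred rat}) (GRing.isZmodClosed.Build rat S Scl).
pose D : zmodType := Quotient.quot I.
have piP (x : rat) : (\pi_D x = 0) <-> x \is a Num.int.
  have -> : (\pi_D x = 0) = (\pi_D x = \pi_D 0) by congr (_ = _); rewrite !piE.
  split=> [/eqP|xi]; first by rewrite -Quotient.idealrBE subr0.
  by apply/eqP; rewrite -Quotient.idealrBE subr0.
have piM (x : rat) (n : nat) : \pi_D (x *+ n) = (\pi_D x : D) *+ n.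
  by elim: n => [|n IH]; rewrite ?mulr0n ?mulrS -?IH !piE.
have piN (x : rat) : \pi_D (- x) = - (\pi_D x : D) by rewrite !piE.
exists D; split=> [d k k0|k k1].
  exists (\pi_D (repr d / k%:R)).
  rewrite -piM -mulrnAl -mulr_natr -mulrA mulfV ?mulr1 ?reprK //.
  by rewrite Num.Theory.pnatr_eq0 -lt0n.
have npi (m : nat) : (1 < m)%N -> ~ \pi_D (m%:R^-1) = 0.
  move=> m1 /piP /Num.Theory.intrP [z e].
  have m0 : (0 : rat) < m%:R by rewrite Num.Theory.ltr0n (ltn_trans _ m1).
  have : (0 : rat) < z%:~R by rewrite -e Num.Theory.invr_gt0.
  have : z%:~R < (1 : rat).
    by rewrite -e Num.Theory.invf_lt1 // Num.Theory.ltr1n.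
  by rewrite ltr0z ltrz1; case: z {e} => [[]|].
case: k k1 => [|[//|k]] _.
  by exists (\pi_D (2%:R^-1)); [exact: npi | move=> n; rewrite dvd0z => /eqP ->].
exists (\pi_D (k.+2%:R^-1)); first exact: npi.
have k0 : (k.+2%:R : rat) != 0 by rewrite Num.Theory.pnatr_eq0.
have kz : (\pi_D (k.+2%:R^-1) : D) *+ k.+2 = 0.
  by rewrite -piM -(mulr_natr k.+2%:R^-1) mulVf //; apply/piP; rewrite rpred1.
by move=> n /dvdzP [q ->]; rewrite mulrC mulrzA -pmulrn kz mul0rz.
Qed.

(** * Extension of homomorphisms into divisible groups *)

Section Extension.
Variables (D : zmodType) (Ddiv : divisible D) (B : zmodType).

Let closed (A : set (B * D)) :=
  (forall p q, A p -> A q -> A (p - q)) /\ (forall y, A (0, y) -> y = 0).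

(** [G] is the graph of a partial homomorphism; Zorn's lemma gives a maximal extension [A], whose
    domain is all of [B] by divisibility. *)
Lemma divisible_extend_graph (G : set (B * D)) :
  G 0 -> (forall p q, G p -> G q -> G (p - q)) ->
  (forall y, G (0, y) -> y = 0) ->
  exists chi : {additive B -> D}, forall p, G p -> chi p.1 = p.2.
Proof.
move=> G0 GB Gf.
(* Containing [G] is asked of nonempty [A] only, so that the union of the empty chain satisfies
   [P]. *)
pose P (A : set (B * D)) := closed A /\ (forall p, A p -> (G `<=` A)%classic).
have [F FP Ft|A [[[AB Af] AG] Amax]] := @Zorn_bigcup _ P.
  split; first split.
  - move=> p q [X FX Xp] [Y FY Yq].
    have [XY|YX] := Ft _ _ FX FY.
      by exists Y => //; apply: (FP _ FY).1.1 => //; apply: XY.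
    by exists X => //; apply: (FP _ FX).1.1 => //; apply: YX.
  - by move=> y [X FX Xy]; exact: (FP _ FX).1.2 Xy.
  by move=> p [X FX Xp] q Gq; exists X => //; apply: (FP _ FX).2 Xp _ Gq.
have GA : (G `<=` A)%classic.
  have [[p Ap]|nA] := pselect (exists p, A p); first exact: (AG _ Ap).
  suff : ~ P G by case; split; [split | move=> _ _].
  apply: Amax.
  split=> [p Ap|GA]; first by case: nA; exists p.
  by apply: nA; exists 0; apply: GA.
have A0 : A 0 by apply: GA.
have AN p : A p -> A (- p) by move=> /(AB _ _ A0); rewrite sub0r.
have AD p q : A p -> A q -> A (p + q).
  by move=> Ap /AN Aq; rewrite -[q]opprK; apply: AB.
have AMn p (n : nat) : A p -> A (p *+ n).
  by move=> Ap; elim: n => [//|n IH]; rewrite mulrS; apply: AD.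
have AM p (n : int) : A p -> A (p *~ n).
  move=> Ap; case: n => n; first exact: AMn.
  by apply: AN; apply: AMn.
have pairM (x : B) (y : D) n : ((x, y) : B * D) *~ n = (x *~ n, y *~ n).
  have hn (m : nat) : ((x, y) : B * D) *+ m = (x *+ m, y *+ m).
    by elim: m => [//|m IH]; rewrite !mulrS IH.
  by case: n => n; [exact: hn | rewrite !NegzE !mulrNz -!pmulrn hn].
have dom x : exists y, A (x, y).
  have [|m n [y Ay] [z Az]|k kP] :=
    @int_subgroup (fun n => exists y, A (x *~ n, y)).
  - by exists 0.
  - by exists (y - z); rewrite mulrzBr; exact: AB Ay Az.
  (* The value to give to [x]: the [n] with [x *~ n] in the domain are the multiples of [k], and [d]
     is the value at [x *~ k] divided by [k], or [0] if [k = 0]. *)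
  have [d dP] : exists d, forall n y, A (x *~ n, y) -> y = d *~ n.
    case: k kP => [|k] kP.
      exists 0 => n y Ay; rewrite mul0rz.
      have /kP : exists y, A (x *~ n, y) by exists y.
      by rewrite dvd0z => /eqP n0; move: Ay; rewrite n0 mulr0z => /Af.
    have /kP [y0 Ay0] : (k.+1 %| k.+1%:Z)%Z by [].
    have [d dy] := Ddiv y0 (ltn0Sn k).
    exists d => n y Ay.
    have /kP /dvdzP [q nq] : exists y, A (x *~ n, y) by exists y.
    have := AB _ _ Ay (AM _ q Ay0); rewrite pairM.
    rewrite nq mulrC mulrzA.
    have -> : ((x *~ k.+1 *~ q, y) - (x *~ k.+1 *~ q, y0 *~ q) : B * D)
              = (0, y - y0 *~ q) by congr pair; exact: subrr.
    by move=> /Af /subr0_eq ->; rewrite mulrzA -dy.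
  pose A' : set (B * D) := fun p => exists q n, A q /\ p = q + (x *~ n, d *~ n).
  have A'x : A' (x, d) by exists 0, 1; rewrite add0r !mulr1z.
  have AA' : (A `<=` A')%classic.
    by move=> p Ap; exists p, 0; rewrite !mulr0z addr0.
  have [A'A|nA'A] := pselect (A' `<=` A)%classic; first by exists d; apply: A'A.
  suff : P A' by move/(Amax A' (conj AA' nA'A)).
  split; last by move=> p _; apply: subset_trans GA AA'.
  split=> [_ _ [q [n [Aq ->]]] [q' [n' [Aq' ->]]]|y [[b z] [n [Aq [e1 e2]]]]].
    exists (q - q'), (n - n'); split; first exact: AB.
    rewrite opprD addrACA; congr (_ + _).
    by rewrite !mulrzBr.
  have /eqP := e1; rewrite eq_sym addrC addr_eq0 => /eqP e.
  have := AN _ Aq; have -> : (- (b, z) : B * D) = (x *~ n, - z).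
    by rewrite e.
  by move=> /dP zd; rewrite e2 -zd addrN.
have [chi chiP] := dep_choice dom.
have uniA x y z : A (x, y) -> A (x, z) -> y = z.
  move=> Ay Az; apply: subr0_eq; apply: Af.
  have := AB _ _ Ay Az; suff -> : ((x, y) - (x, z) : B * D) = (0, y - z) by [].
  by congr pair; exact: subrr.
have chi_add : zmod_morphism chi.
  by move=> x y; apply: (@uniA (x - y)) => //; exact: AB (chiP x) (chiP y).
pose c : {additive B -> D} := HB.pack chi (GRing.isZmodMorphism.Build B D chi chi_add).
exists c.
by move=> [x y] /GA /= Axy; exact: uniA (chiP x) Axy.
Qed.

Lemma divisible_extend (C : zmodType) (f : {additive C -> B}) (g : {additive C -> D}) :
  injective f -> exists h : {additive B -> D}, forall x, h (f x) = g x.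
Proof.
move=> fi; have [||y [x [/= fx <-]]|h hP] :=
  @divisible_extend_graph (fun p => exists x, f x = p.1 /\ g x = p.2).
- by exists 0; rewrite !raddf0.
- move=> p q [x [fx gx]] [x' [fx' gx']]; exists (x - x').
  by rewrite !raddfB fx gx fx' gx'.
- by rewrite (_ : x = 0) ?raddf0 //; apply: fi; rewrite fx raddf0.
by exists h => x; apply: (hP (f x, g x)); exists x.
Qed.

(** Send [A] to [0] and [b] to a nonzero element of [D] killed by the order [k] of [b] modulo [A],
    then extend; [k] is not [1] since [b] lies outside [A]. *)
Lemma separate_subgroup (Dtor : has_torsion D) (A : B -> Prop) (b : B) :
  A 0 -> (forall x y, A x -> A y -> A (x - y)) -> ~ A b ->
  exists chi : {additive B -> D}, (forall x, A x -> chi x = 0) /\ chi b <> 0.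
Proof.
move=> A0 AB nAb.
have [//|m n Am An|k kP] := @int_subgroup (fun n => A (b *~ n)).
  by rewrite mulrzBr; exact: AB.
have k1 : k <> 1%N.
  move=> k1; apply: nAb; have /kP : (k %| 1)%Z by rewrite k1.
  by rewrite mulr1z.
have [d d0 dk] := Dtor k k1.
have [||y [x [n [Ax [e1 ->]]]]|chi chiP] := @divisible_extend_graph
  (fun p => exists x n, A x /\ p = (x + b *~ n, d *~ n)).
- by exists 0, 0; rewrite !mulr0z addr0.
- move=> _ _ [x [n [Ax ->]]] [y [m [Ay ->]]]; exists (x - y), (n - m).
  split; first exact: AB.
  rewrite !mulrzBr; congr pair => /=.
  by rewrite opprD addrACA.
- apply: dk; apply/kP; have /eqP := e1; rewrite eq_sym addrC addr_eq0 => /eqP ->.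
  by rewrite -sub0r; apply: AB.
exists chi; split=> [x Ax|].
  by apply: (chiP (x, 0)); exists x, 0; rewrite !mulr0z addr0.
suff -> : chi b = d by [].
by apply: (chiP (b, d)); exists 0, 1; rewrite !mulr1z add0r.
Qed.

End Extension.

(** * Injective modules *)

Section Products.
Variables (R : pzRingType) (I : Type).

Fact prod_pair_linear (U : lmodType R) (M : I -> lmodType R)
  (h : forall i, {linear U -> M i}) : linear ((fun u i => h i u) : U -> modprod M).
Proof. by move=> a x y; apply: functional_extensionality_dep => i; rewrite linearP. Qed.

Definition prod_pair (U : lmodType R) (M : I -> lmodType R)
  (h : forall i, {linear U -> M i}) : {linear U -> modprod M} :=
  mklin (prod_pair_linear h).

Fact prod_proj_linear (M : I -> lmodType R) i : linear ((fun f => f i) : modprod M -> M i).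
Proof. by []. Qed.

Definition prod_proj (M : I -> lmodType R) i : {linear modprod M -> M i} :=
  mklin (@prod_proj_linear M i).

Lemma injective_modprod (M : I -> lmodType R) :
  (forall i, injective_mod (M i)) -> injective_mod (modprod M).
Proof.
move=> inj U V f g fi.
have [h hP] := dep_choice (fun i => inj i U V f (prod_proj M i \o g) fi).
by exists (prod_pair h) => x; apply: functional_extensionality_dep => i; exact: hP.
Qed.

End Products.

Lemma injective_retract (R : pzRingType) (E N : lmodType R)
    (i : {linear N -> E}) (r : {linear E -> N}) :
  (forall x, r (i x) = x) -> injective_mod E -> injective_mod N.
Proof.
move=> ri inj U V f g fi; have [h hP] := inj U V f (i \o g) fi.
by exists (r \o h) => x /=; rewrite hP /= ri.
Qed.

Lemma injective_extend_ker (R : pzRingType) (E M N : lmodType R)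
    (f : {linear M -> N}) (g : {linear M -> E}) :
  injective_mod E -> (forall x, f x = 0 -> g x = 0) ->
  exists h : {linear N -> E}, forall x, h (f x) = g x.
Proof.
move=> inj fg.
have [C [p [f' [ps f'i f'P]]]] := image_exists f.
have pf x : p x = 0 -> f x = 0 by move=> px; rewrite -f'P px linear0.
have [g' g'P] := factor_surj ps (fun x e => fg x (pf x e)).
have [h hP] := inj C N f' g' f'i.
by exists h => x; rewrite -f'P hP g'P.
Qed.

(** * Coinduced modules and enough injectives *)

Section Coinduced.
Variables (R : pzRingType) (D : zmodType).

Definition coind : Type := {additive R -> D}.

HB.instance Definition _ := gen_eqMixin coind.
HB.instance Definition _ := gen_choiceMixin coind.

Let add (f g : coind) : coind := (f : {additive R -> D}) \+ (g : {additive R -> D}).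
Let opp (f : coind) : coind := \- (f : {additive R -> D}).
Let zero : coind := \0 : R -> D.
Let rmul (r : R) : {additive R -> R} := HB.pack (fun x : R => x * r)
  (GRing.isZmodMorphism.Build R R (fun x : R => x * r) (fun x y => mulrBl r x y)).
Let scale (r : R) (f : coind) : coind := (f : {additive R -> D}) \o rmul r.

Let addA : associative add.
Proof. by move=> f g h; apply: additive_ext => x /=; rewrite addrA. Qed.
Let addC : commutative add.
Proof. by move=> f g; apply: additive_ext => x /=; rewrite addrC. Qed.
Let add0 : left_id zero add.
Proof. by move=> f; apply: additive_ext => x /=; rewrite add0r. Qed.
Let addN : left_inverse zero opp add.
Proof. by move=> f; apply: additive_ext => x /=; rewrite addNr. Qed.

HB.instance Definition _ := GRing.isZmodule.Build coind addA addC add0 addN.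

Let scaleA (a b : R) (f : coind) : scale a (scale b f) = scale (a * b) f.
Proof. by apply: additive_ext => x /=; rewrite mulrA. Qed.
Let scale1 : left_id 1 scale.
Proof. by move=> f; apply: additive_ext => x /=; rewrite mulr1. Qed.
Let scaleDr : right_distributive scale +%R.
Proof. by move=> a f g; apply: additive_ext. Qed.
Let scaleDl (f : coind) : {morph scale^~ f : a b / a + b}.
Proof. by move=> a b; apply: additive_ext => x /=; rewrite mulrDr raddfD. Qed.

HB.instance Definition _ :=
  GRing.Zmodule_isLmodule.Build R coind scaleA scale1 scaleDr scaleDl.

Definition coind_app (f : coind) : {additive R -> D} := f.

Lemma coind_ext (f g : coind) : (forall r, coind_app f r = coind_app g r) -> f = g.
Proof. exact: additive_ext. Qed.

(** One direction of the adjunction between characters of [M] and linear maps from [M] to [coind];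
    the inverse is evaluation at [1]. *)
Lemma coind_transpose (M : lmodType R) (chi : {additive M -> D}) :
  exists h : {linear M -> coind}, forall x r, coind_app (h x) r = chi (r *: x).
Proof.
have ha x : zmod_morphism (fun r : R => chi (r *: x)).
  by move=> r s; rewrite scalerBl raddfB.
pose h x : coind := (HB.pack (fun r : R => chi (r *: x))
  (GRing.isZmodMorphism.Build R D _ (ha x)) : {additive R -> D}).
have hl : linear h.
  move=> a x y; apply: additive_ext => r /=.
  by rewrite scalerDr raddfD scalerA.
by exists (mklin hl).
Qed.

(** Evaluation at [1] turns a map into [coind] into a character, which extends by divisibility and
    is transposed back. *)
Lemma injective_coind : divisible D -> injective_mod coind.
Proof.
move=> Ddiv M N f g fi.
have ga : zmod_morphism (fun x => coind_app (g x) 1).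
  by move=> x y; rewrite linearB.
pose g1 : {additive M -> D} := HB.pack (fun x => coind_app (g x) 1)
  (GRing.isZmodMorphism.Build M D _ ga).
have [chi chiP] := divisible_extend Ddiv (f := f) g1 fi.
have [h hP] := coind_transpose chi.
exists h => x; apply: coind_ext => r.
by rewrite hP -linearZ chiP /= linearZ /coind_app /= mul1r.
Qed.

End Coinduced.

(** [M] maps to a product of coinduced modules indexed by its characters, which separate its
    points. *)
Lemma injective_embedding (R : pzRingType) (M : lmodType R) :
  exists (E : lmodType R) (i : {linear M -> E}), injective_mod E /\ injective i.
Proof.
have [D [Ddiv Dtor]] := divisible_torsion_exists.
have [h hP] := dep_choice (@coind_transpose R D M).
exists (modprod (fun _ : {additive M -> D} => coind R D)), (prod_pair h).
split; first by apply: injective_modprod => _; exact: injective_coind.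
apply: inj_ker0 => x hx; apply: contrapT => x0.
have [//|_ _ -> ->|chi [_ nz]] :=
  separate_subgroup Ddiv Dtor (A := fun y => y = 0) _ _ x0; first exact: subrr.
apply: nz; have := hP chi x 1; rewrite scale1r => <-.
by have -> : h chi x = 0 by exact: (congr1 (fun F : modprod _ => F chi) hx).
Qed.

(** * Coherence and fp-injective modules *)

Section Coherence.
Variable R : pzRingType.
Implicit Types L M N E P : lmodType R.

Lemma lincomb_linear n M (s : 'I_n -> M) :
  linear (fun u : 'rV[R]_n => \sum_j u 0 j *: s j).
Proof.
move=> a u v; rewrite scaler_sumr -big_split; apply: eq_bigr => j _ /=.
by rewrite !mxE scalerDl scalerA.
Qed.

Definition lincomb n M (s : 'I_n -> M) : {linear 'rV[R]_n -> M} :=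
  mklin (lincomb_linear s).

Definition unit_row n (j : 'I_n) : 'rV[R]_n := delta_mx 0 j.

Lemma lincomb_unit n M (s : 'I_n -> M) j : lincomb s (unit_row j) = s j.
Proof.
rewrite /= (bigD1 j) //= big1 => [|i ij]; rewrite mxE eqxx /=.
  by rewrite eqxx scale1r addr0.
by rewrite (negbTE ij) scale0r.
Qed.

Lemma row_linear_sum n M (f : {linear 'rV[R]_n -> M}) u :
  f u = \sum_j u 0 j *: f (unit_row j).
Proof.
rewrite {1}[u]row_sum_delta linear_sum; apply: eq_bigr => j _.
by rewrite linearZ.
Qed.

Lemma row_linear_ext n M (f g : {linear 'rV[R]_n -> M}) :
  (forall j, f (unit_row j) = g (unit_row j)) -> forall u, f u = g u.
Proof.
by move=> fg u; rewrite !row_linear_sum; apply: eq_bigr => j _; rewrite fg.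
Qed.

Lemma projective_row n : projective_mod ('rV[R]_n).
Proof.
move=> M N f g fs; have [s sP] := dep_choice (fun j => fs (g (unit_row j))).
exists (lincomb s) => x; apply: (row_linear_ext (f := f \o lincomb s)) => j.
by rewrite [LHS](congr1 f (lincomb_unit s j)).
Qed.

(** The form in which left coherence enters the later arguments. *)
Definition kernels_fin_generated :=
  forall m n (q : {linear 'rV[R]_m -> 'rV[R]_n}),
  exists k (s : {linear 'rV[R]_k -> 'rV[R]_m}), exact_at s q.

(* Schanuel's lemma. *)
Lemma fin_presented_kernel M k (p : {linear 'rV[R]_k -> M}) :
  fin_presented M -> surj p ->
  exists l (s : {linear 'rV[R]_l -> 'rV[R]_k}), exact_at s p.
Proof.
move=> [a [b [q [p' [qp p's]]]]] ps.
have [al alP] := projective_row p' ps.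
have [be beP] := projective_row p p's.
(* The kernel of [p] is generated by the images under [al] of the relations [q] and by the
   differences [y - al (be y)]. *)
have sl : linear (fun u : 'rV[R]_(a + k) =>
  al (q (lsubmx u)) + (rsubmx u - al (be (rsubmx u)))).
  by move=> r u v; rewrite !linearP /= !scalerDr [RHS]addrACA; congr (_ + _); exact: addrACA.
exists (a + k)%N, (mklin sl) => y; split=> [py|[u <-]] /=.
  have /qp [z zP] : p' (be y) = 0 by rewrite beP.
  by exists (row_mx z y); rewrite /= row_mxKl row_mxKr zP addrC subrK.
rewrite linearD linearB /= !alP beP subrr addr0.
by apply/qp; exists (lsubmx u).
Qed.

(** The image of a map to [R^o] is a finitely generated left ideal, finitely presented by coherence.
    For larger [n], the first coordinate is restricted to the kernel of the others. *)
Lemma coherent_kernels : left_coherent R -> kernels_fin_generated.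
Proof.
move=> HR.
have base m (q : {linear 'rV[R]_m -> R^o}) :
    exists k (s : {linear 'rV[R]_k -> 'rV[R]_m}), exact_at s q.
  have [I [p [i [ps ii ip]]]] := image_exists q.
  have [|k [s se]] := @fin_presented_kernel I m p _ ps.
    by apply: (HR I i ii); exists m, p.
  exists k, s => y; rewrite -se -ip.
  by split=> [/(ker0_inj ii)|->]; rewrite ?linear0.
move=> m n; elim: n m => [|n IH] m q.
  exists m, (mklin (f := id) (fun _ _ _ => erefl)) => y.
  by split=> _; [exists y | apply/rowP => -[]].
have q1l : linear (fun u => \row_j (q u) 0 (lift ord0 j)).
  by move=> a u v; apply/rowP => j; rewrite linearP !mxE.
have q2l : linear (fun u => (q u) 0 ord0 : R^o).
  by move=> a u v; rewrite linearP !mxE.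
have [k [s se]] := IH m (mklin q1l).
have [l [t te]] := base k (mklin q2l \o s).
exists l, (s \o t) => y; split=> [qy|[x <-]] /=.
  have /se [z zy] : mklin q1l y = 0 by apply/rowP => j; rewrite /= qy !mxE.
  have /te [x xz] : (mklin q2l \o s) z = 0 by rewrite /= zy qy mxE.
  by exists x; rewrite /= xz.
have e2 : (mklin q2l \o s) (t x) = 0 by apply/te; exists x.
have e1 : mklin q1l (s (t x)) = 0 by apply/se; exists (t x).
apply/rowP => j; case: (unliftP ord0 j) => [j' ->|->]; rewrite mxE.
  by have /rowP /(_ j') := e1; rewrite /= !mxE.
exact: e2.
Qed.

(* Equivalently, [Ext^1(P, L) = 0] for every finitely presented [P]. *)
Definition fp_injective_mod L :=
  forall m n (q : {linear 'rV[R]_m -> 'rV[R]_n}) (g : {linear 'rV[R]_m -> L}),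
    (forall x, q x = 0 -> g x = 0) ->
    exists h : {linear 'rV[R]_n -> L}, forall x, h (q x) = g x.

Lemma injective_fp_injective L : injective_mod L -> fp_injective_mod L.
Proof. by move=> inj m n q g; exact: injective_extend_ker. Qed.

Lemma fp_injective_modprod (I : Type) (M : I -> lmodType R) :
  (forall i, fp_injective_mod (M i)) -> fp_injective_mod (modprod M).
Proof.
move=> inj m n q g qg.
have [h hP] := dep_choice (fun i => inj i m n q (prod_proj M i \o g)
  (fun x qx => congr1 (prod_proj M i) (qg x qx))).
by exists (prod_pair h) => x; apply: functional_extensionality_dep => i; exact: hP.
Qed.

Section ShortExact.
Variables (L E C : lmodType R) (i : {linear L -> E}) (p : {linear E -> C}).
Hypotheses (Linj : fp_injective_mod L) (i_inj : injective i) (ip : exact_at i p)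
  (p_surj : surj p).

(** Lift [c] to the free cover of [P]. On the relations this lift takes values in [L], and
    fp-injectivity provides the correction that makes it vanish there. *)
Lemma fp_injective_lift P (c : {linear P -> C}) :
  fin_presented P -> exists h : {linear P -> E}, forall x, p (h x) = c x.
Proof.
move=> [m [n [q [r [qr rs]]]]].
have rq x : r (q x) = 0 by apply/qr; exists x.
have [phi phiP] := projective_row (c \o r) p_surj.
have phiq x : p (phi (q x)) = 0 by rewrite phiP /= rq linear0.
have [g gP] := factor_inj (g := phi \o q) i_inj (fun x => (ip _).1 (phiq x)).
have [|h hP] := Linj (q := q) (g := g).
  by move=> x qx; apply: i_inj; rewrite gP /= qx !linear0.
have ker x : r x = 0 -> phi x - i (h x) = 0.
  by move=> /qr [z <-]; rewrite hP gP subrr.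
have [k kP] := factor_surj (g := phi \- (i \o h)) rs ker.
exists k => y; have [x <-] := rs y.
rewrite kP /= linearB /= phiP /=; have -> : p (i (h x)) = 0 by apply/ip; exists (h x).
by rewrite subr0.
Qed.

Hypothesis E_inj : injective_mod E.

(** By coherence the image of [q] is finitely presented, so the map that [g] induces on it lifts to
    [E] and then extends by injectivity of [E]. *)
Lemma fp_injective_coker : kernels_fin_generated -> fp_injective_mod C.
Proof.
move=> coh m n q g qg.
have [I [r [j [rs ji jr]]]] := image_exists q.
have Ifp : fin_presented I.
  have [k [s sq]] := coh m n q; exists k, m, s, r; split=> // x.
  by rewrite -sq -jr; split=> [->|/(ker0_inj ji)//]; rewrite linear0.
have rg x : r x = 0 -> g x = 0 by move=> rx; apply: qg; rewrite -jr rx linear0.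
have [c cP] := factor_surj rs rg.
have [k kP] := fp_injective_lift c Ifp.
have [h hP] := E_inj k ji.
by exists (p \o h) => x; rewrite -jr /= hP kP cP.
Qed.

(** A cocycle in [L] bounds a cochain in [E], which induces a map from [P] to [C]; subtracting a
    lift of that map to [E] brings the cochain into [L]. *)
Lemma Ext1_fp_injective P : fin_presented P -> Ext_vanishes 1 P L.
Proof.
move=> Pfp F g gd.
have dg x : res_d F 0 x = 0 -> i (g x) = 0.
  by move=> /(@res_exact _ _ F 0) [y <-]; rewrite gd linear0.
have [e eP] := injective_extend_ker (g := i \o g) E_inj dg.
have aug x : res_aug F x = 0 -> p (e x) = 0.
  by move=> /(@res_exact0 _ _ F) [y <-]; rewrite eP /=; apply/ip; exists (g y).
have [c cP] := factor_surj (p := res_aug F) (g := p \o e) (@res_surj _ _ F) aug.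
have [k kP] := fp_injective_lift c Pfp.
have pek x : p (e x - k (res_aug F x)) = 0 by rewrite linearB kP cP subrr.
have [h hP] := factor_inj (g := e \- (k \o res_aug F)) i_inj
  (fun x => (ip _).1 (pek x)).
exists h => x; apply: i_inj; rewrite hP /= eP /=.
have -> : res_aug F (res_d F 0 x) = 0 by apply/(@res_exact0 _ _ F); exists x.
by rewrite linear0 subr0.
Qed.

(** Surjectivity, for injective [E], of the connecting map from Ext of [C] to Ext of [L] one degree
    higher, carried out on cocycles. *)
Lemma Ext_dimension_shift n P : Ext_vanishes n.+1 P C -> Ext_vanishes n.+2 P L.
Proof.
move=> van F g gd.
have dg x : res_d F n.+1 x = 0 -> i (g x) = 0.
  by move=> /(@res_exact _ _ F n.+1) [y <-]; rewrite gd linear0.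
have [e eP] := injective_extend_ker (g := i \o g) E_inj dg.
have [|h hP] := van F (p \o e).
  by move=> x; rewrite /= eP; apply/ip; exists (g x).
have [k kP] := @res_proj _ _ F n E C p h p_surj.
have pek x : p (e x - k (res_d F n x)) = 0 by rewrite linearB kP hP subrr.
have [h' h'P] := factor_inj (g := e \- (k \o res_d F n)) i_inj
  (fun x => (ip _).1 (pek x)).
exists h' => x; apply: i_inj; rewrite h'P /= eP /=.
have -> : res_d F n (res_d F n.+1 x) = 0 by apply/(@res_exact _ _ F n); exists x.
by rewrite linear0 subr0.
Qed.

End ShortExact.

Lemma injective_ses L : exists (E C : lmodType R) (i : {linear L -> E})
    (p : {linear E -> C}), [/\ injective_mod E, injective i, exact_at i p & surj p].
Proof.
have [E [i [Einj ii]]] := injective_embedding L.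
have [C [p [ps ip]]] := coker_exists i.
by exists E, C, i, p.
Qed.

(** Dimension shifting along injective embeddings, whose cokernels stay fp-injective by
    coherence. *)
Lemma fp_injective_strongly L :
  kernels_fin_generated -> fp_injective_mod L -> strongly_fp_injective_mod L.
Proof.
move=> coh Linj P [//|n] Pfp _.
elim: n L Linj => [|n IH] L Linj; have [E [C [i [p [Einj ii ip ps]]]]] := injective_ses L.
  exact: Ext1_fp_injective Linj ii ip ps Einj P Pfp.
apply: (Ext_dimension_shift ii ip ps Einj); apply: IH.
exact: (fp_injective_coker Linj ii ip ps Einj).
Qed.

(** Kernels are covered repeatedly by finite free modules. The mutually inverse maps record that the
    first two terms are the given ones, without equalities of modules. *)
Lemma free_resolution P m n (q : {linear 'rV[R]_m -> 'rV[R]_n})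
    (p : {linear 'rV[R]_n -> P}) :
  kernels_fin_generated -> exact_at q p -> surj p ->
  exists F : proj_resolution P, 
    exists (f1 : {linear 'rV[R]_m -> F 1%N}) (f0 : {linear F 0%N -> 'rV[R]_n})
      (e1 : {linear F 1%N -> 'rV[R]_m}) (e0 : {linear 'rV[R]_n -> F 0%N}),
    [/\ forall x, f0 (res_d F 0 (f1 x)) = q x, forall x, e1 (f1 x) = x,
        forall x, f1 (e1 x) = x, forall x, f0 (e0 x) = x & forall x, e0 (f0 x) = x].
Proof.
move=> coh qp ps.
pose st := {a : nat & {b : nat & {linear 'rV[R]_a -> 'rV[R]_b}}}.
have next (s : st) : {k : nat & {t : {linear 'rV[R]_k -> 'rV[R]_(projT1 s)} |
    exact_at t (projT2 (projT2 s))}}.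
  by case: s => a [b t]; have /cid [k /cid [u uP]] := coh a b t; exists k, u.
pose step (s : st) : st :=
  existT _ (projT1 (next s)) (existT _ (projT1 s) (sval (projT2 (next s)))).
pose S k := iter k step (existT _ m (existT _ n q)).
pose F : proj_resolution P := @ProjResolution R P
  (fun k => 'rV[R]_(projT1 (projT2 (S k))))
  (fun k => projT2 (projT2 (S k)))
  p (fun k => @projective_row _) ps qp (fun k => svalP (projT2 (next (S k)))).
pose idl k : {linear 'rV[R]_k -> 'rV[R]_k} := mklin (f := id) (fun _ _ _ => erefl).
by exists F, (idl m), (idl n), (idl m), (idl n).
Qed.

(** A map [g] vanishing on the kernel of [q] is a 1-cocycle on a free resolution of the cokernel of
    [q] that begins with [q]. *)
Lemma strongly_fp_injective L :
  kernels_fin_generated -> strongly_fp_injective_mod L -> fp_injective_mod L.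
Proof.
move=> coh Linj m n q g qg.
have [C [p [ps qp]]] := coker_exists q.
have Cfp : fin_presented C by exists m, n, q, p.
have [F [f1 [f0 [e1 [e0 [qE ef1 fe1 fe0 ef0]]]]]] := free_resolution coh qp ps.
have [|h hP] := Linj C 1%N Cfp isT F (g \o e1).
  move=> x /=; apply: qg; rewrite -qE fe1.
  have -> : res_d F 0 (res_d F 1 x) = 0 by apply/(@res_exact _ _ F 0); exists x.
  by rewrite linear0.
by exists (h \o e0) => x /=; rewrite -qE ef0 hP /= ef1.
Qed.

End Coherence.

(** * Representations of right rooted quivers *)

Section RepTools.
Variables (Q : quiver) (R : pzRingType).
Implicit Types X Y Z : rep Q R.

Definition rep_comp X Y Z (g : rep_hom Y Z) (f : rep_hom X Y) : rep_hom X Z :=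
  @RepHom Q R X Z (fun i => g i \o f i) (fun i j a x =>
    etrans (congr1 (g j) (hom_nat f a x)) (hom_nat g a (f i x))).

Fact rep_sub_nat X Y (f g : rep_hom X Y) (i j : Q) (a : arrow i j) (x : X i) :
  (f j \- g j) (rep_map X a x) = rep_map Y a ((f i \- g i) x).
Proof. by rewrite /= !hom_nat linearB. Qed.

Definition rep_sub X Y (f g : rep_hom X Y) : rep_hom X Y :=
  @RepHom Q R X Y (fun i => f i \- g i) (rep_sub_nat f g).

Definition rep_id X : rep_hom X X :=
  @RepHom Q R X X (fun i => mklin (f := id) (fun _ _ _ => erefl))
    (fun i j a x => erefl).

Lemma rep_factor_epi X Y Z (p : rep_hom X Y) (g : rep_hom X Z) :
  rep_epi p -> (forall i x, p i x = 0 -> g i x = 0) ->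
  exists h : rep_hom Y Z, forall i x, h i (p i x) = g i x.
Proof.
move=> pe pg; have [h hP] := dep_choice (fun i => factor_surj (pe i) (pg i)).
have hn (i j : Q) (a : arrow i j) y : h j (rep_map Y a y) = rep_map Z a (h i y).
  by have [x <-] := pe i y; rewrite -hom_nat !hP hom_nat.
by exists (@RepHom Q R Y Z h hn).
Qed.

Lemma rep_factor_mono X Y Z (m : rep_hom Y Z) (g : rep_hom X Z) :
  rep_mono m -> (forall i x, exists y, m i y = g i x) ->
  exists h : rep_hom X Y, forall i x, m i (h i x) = g i x.
Proof.
move=> mm mg; have [h hP] := dep_choice (fun i => factor_inj (@mm i) (mg i)).
have hn (i j : Q) (a : arrow i j) x : h j (rep_map X a x) = rep_map Y a (h i x).
  by apply: mm; rewrite hom_nat !hP hom_nat.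
by exists (@RepHom Q R X Y h hn).
Qed.

Lemma rep_coker_exists X Y (f : rep_hom X Y) :
  exists (C : rep Q R) (p : rep_hom Y C), rep_epi p /\ rep_exact f p.
Proof.
have [C /dep_choice [p pP]] := dep_choice (fun i => coker_exists (f i)).
have kp (i j : Q) (a : arrow i j) y : p i y = 0 -> (p j \o rep_map Y a) y = 0.
  move=> /(pP i).2 [x <-] /=; rewrite -hom_nat; apply/(pP j).2.
  by exists (rep_map X a x).
have [m mP] := dep_choice (fun i => dep_choice (fun j => dep_choice (fun a =>
  factor_surj (pP i).1 (kp i j a)))).
exists (Rep m), (@RepHom Q R Y (Rep m) p (fun i j a x => esym (mP i j a x))).
by split=> i; case: (pP i).
Qed.

Lemma rep_ker_exists Y Z (g : rep_hom Y Z) :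
  exists (K : rep Q R) (k : rep_hom K Y), is_kernel k g.
Proof.
pose v i : {linear kermod (g i) -> Y i} :=
  mklin (f := @ker_val R (Y i) (Z i) (g i)) (fun _ _ _ => erefl).
have vi i : injective (v i) by move=> x y; exact: val_inj.
have ve i y : g i y = 0 -> exists x, v i x = y.
  by move=> /eqP gy; exists (Kermod gy).
have v0 i x : g i (v i x) = 0 by case: x => x gx; apply/eqP.
have kp (i j : Q) (a : arrow i j) x : exists z, v j z = (rep_map Y a \o v i) x.
  by apply: ve; rewrite /= hom_nat v0 linear0.
have [m mP] := dep_choice (fun i => dep_choice (fun j => dep_choice (fun a =>
  factor_inj (@vi j) (kp i j a)))).
exists (Rep m), (@RepHom Q R (Rep m) Y v (fun i j a x => mP i j a x)).
by split=> i // y; split=> [/ve //|[x <-]]; exact: v0.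
Qed.

Lemma psi_nat X Y (f : rep_hom X Y) v (x : X v) (a : arrows_from v) :
  psi (f v x) a = f (projT1 a) (psi x a).
Proof. by rewrite /psi hom_nat. Qed.

End RepTools.

Section Rooted.
Variable Q : quiver.

(** The target comes first, so that well-founded induction goes from the targets of the arrows to
    their source. *)
Definition successor (w v : Q) := inhabited (arrow v w).

(** A vertex that is not accessible has a successor that is not accessible; iteration yields an
    infinite path. *)
Lemma right_rooted_wf : right_rooted Q -> well_founded successor.
Proof.
move=> rooted v; apply: contrapT => nAv; apply: rooted.
have next (s : {v : Q | ~ Acc successor v}) :
    {t : {v : Q | ~ Acc successor v} | successor (sval t) (sval s)}.
  case: s => u nu; apply: cid; apply: contrapT => h; apply: (nu); constructor=> w wu.
  by apply: contrapT => nw; apply: h; exists (exist _ w nw).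
pose S n := iter n (fun s => sval (next s)) (exist _ v nAv).
exists (fun n => sval (S n)).
have [f _] := @dep_choice nat (fun n => arrow (sval (S n)) (sval (S n.+1)))
  (fun _ _ => True) (fun n => let: inhabits a := svalP (next (S n)) in ex_intro _ a I).
by constructor.
Qed.

Hypothesis rooted : right_rooted Q.

Lemma successor_ind (P : Q -> Prop) :
  (forall v, (forall a : arrows_from v, P (projT1 a)) -> P v) -> forall v, P v.
Proof.
move=> h; apply: (well_founded_ind (right_rooted_wf rooted)) => v IH.
by apply: h => -[w a]; apply: IH.
Qed.

(* Morphisms out of a representation of a right rooted quiver can be
   constructed one vertex at a time, starting from the sinks. *)
Lemma rep_hom_rec (R : pzRingType) (A B : rep Q R)
    (P : forall v, {linear A v -> B v} -> Prop) :
  (forall v (l : forall a : arrows_from v, {linear A (projT1 a) -> B (projT1 a)}),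
     (forall a, P _ (l a)) ->
     exists2 h : {linear A v -> B v}, P v h &
       forall x a, psi (h x) a = l a (psi x a)) ->
  exists h : rep_hom A B, forall v, P v (h v).
Proof.
move=> ext; pose T v := {h : {linear A v -> B v} | P v h}.
(* Naturality at [v] involves the maps chosen at the targets, so it is stated relative to the
   recursive values and recovered from the fixpoint equation [hE]. *)
pose ok v (rec : forall w, successor w v -> T w) (h : T v) :=
  forall x (a : arrows_from v),
    psi (sval h x) a = sval (rec _ (inhabits (projT2 a))) (psi x a).
have step v rec : {h : T v | @ok v rec h}.
  apply: cid.
  have [a|h Ph hP] := @ext v (fun a => sval (rec _ (inhabits (projT2 a)))).
    exact: svalP.
  by exists (exist _ h Ph).
pose F v rec := sval (step v rec).
pose h := Fix (right_rooted_wf rooted) T F.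
have hE v : h v = F v (fun w _ => h w).
  apply: Fix_eq => u f g fg; congr (F u _).
  by apply: functional_extensionality_dep => w; apply: functional_extensionality_dep.
have hP v : ok v (fun w _ => h w) (h v) by rewrite hE; exact: svalP.
exists (@RepHom Q R A B (fun v => sval (h v))
  (fun i j a x => esym (hP i x (existT _ j a)))).
by move=> v; exact: svalP.
Qed.

End Rooted.

(** * Cofree representations *)

Section Cofree.
Variables (Q : quiver) (R : pzRingType).

(** Paths grow at their source, so that morphisms between cofree representations are natural by
    computation. *)
Inductive path_from (i : Q) : Type :=
| here
| step (j : Q) of arrow i j & path_from j.

Arguments here {i}.

Fixpoint path_end (i : Q) (p : path_from i) : Q :=
  match p with here => i | step j _ q => path_end q end.

Definition cofree_ob (M : Q -> lmodType R) (i : Q) : lmodType R :=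
  modprod (fun p : path_from i => M (path_end p)).

Fact cofree_map_linear (M : Q -> lmodType R) (i j : Q) (a : arrow i j) :
  linear ((fun x q => x (step a q)) : cofree_ob M i -> cofree_ob M j).
Proof. by []. Qed.

(** The right adjoint of forgetting the arrows, with transpose [to_cofree] and counit
    [cofree_here]. *)
Definition cofree (M : Q -> lmodType R) : rep Q R :=
  Rep (fun i j a => mklin (@cofree_map_linear M i j a)).

Definition cofree_hom (M N : Q -> lmodType R) (f : forall v, {linear M v -> N v}) :
  rep_hom (cofree M) (cofree N) :=
  @RepHom Q R (cofree M) (cofree N)
    (fun i => prod_pair (fun p : path_from i =>
       f (path_end p) \o prod_proj (fun p : path_from i => M (path_end p)) p))
    (fun i j a x => erefl).

Fixpoint path_act (X : rep Q R) (i : Q) (p : path_from i) : X i -> X (path_end p) :=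
  match p with
  | here => id
  | step j a q => fun x => @path_act X j q (rep_map X a x)
  end.

Lemma path_act_linear (X : rep Q R) (i : Q) (p : path_from i) :
  linear (@path_act X i p).
Proof. by elim: p => //= {}i j a q IH r x y; rewrite linearP IH. Qed.

Definition to_cofree (X : rep Q R) (M : Q -> lmodType R)
    (f : forall v, {linear X v -> M v}) : rep_hom X (cofree M) :=
  @RepHom Q R X (cofree M)
    (fun i => prod_pair (fun p : path_from i =>
       f (path_end p) \o mklin (@path_act_linear X i p)))
    (fun i j a x => erefl).

(** If [to_cofree f] kills [x], it kills the images of [x] along all arrows; these vanish by
    induction from the sinks, so [psi x = 0]. *)
Lemma to_cofree_mono (X : rep Q R) (M : Q -> lmodType R)
    (f : forall v, {linear X v -> M v}) :
  right_rooted Q ->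
  (forall v x, @psi Q R X v x = 0 -> f v x = 0 -> x = 0) -> rep_mono (to_cofree f).
Proof.
move=> rooted fi v; apply: inj_ker0; elim/(successor_ind rooted): v => v IH x fx0.
have fx p : to_cofree f v x p = 0 by exact: (congr1 (fun F : cofree_ob M v => F p) fx0).
apply: fi; last exact: (fx here).
apply: functional_extensionality_dep => a; apply: IH.
by apply: functional_extensionality_dep => q; exact: (fx (step (projT2 a) q)).
Qed.

(** Identifies [M v] with the kernel of [psi] at [v]: the families supported on the trivial path. *)
Definition cofree_sub (M : Q -> lmodType R) v : M v -> cofree M v :=
  fun m p => match p return M (path_end p) with here => m | step _ _ _ => 0 end.

Fact cofree_sub_linear (M : Q -> lmodType R) v : linear (@cofree_sub M v).
Proof.
move=> r x y; apply: functional_extensionality_dep => -[|j a q] //=.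
by symmetry; rewrite /GRing.add /GRing.scale /= scaler0 addr0.
Qed.

HB.instance Definition _ (M : Q -> lmodType R) v :=
  GRing.isLinear.Build R (M v) (cofree M v) *:%R (@cofree_sub M v)
    (@cofree_sub_linear M v).

Lemma psi_cofree_sub (M : Q -> lmodType R) v (m : M v) : psi (cofree_sub m) = 0.
Proof. by apply: functional_extensionality_dep. Qed.

Lemma psi_cofree_eq0 (M : Q -> lmodType R) v (x : cofree M v) :
  psi x = 0 -> x = cofree_sub (x here).
Proof.
move=> x0; apply: functional_extensionality_dep => -[//|j a q].
exact: (congr1 (fun F : modprod (fun a => cofree M (projT1 a)) =>
  (F (existT _ j a) : cofree_ob M j) q) x0).
Qed.

Lemma psi_cofree_surj (M : Q -> lmodType R) v : surj (@psi Q R (cofree M) v).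
Proof.
move=> y; exists (fun p => match p return M (path_end p) with
  here => 0 | step j a q => (y (existT _ j a) : cofree M j) q end).
by apply: functional_extensionality_dep => -[j a].
Qed.

Fact cofree_here_linear (M : Q -> lmodType R) v :
  linear ((fun x => x here) : cofree M v -> M v).
Proof. by []. Qed.

Definition cofree_here (M : Q -> lmodType R) v : {linear cofree M v -> M v} :=
  mklin (@cofree_here_linear M v).

End Cofree.

Arguments here {Q i}.

(** * Injective representations *)

Section InjectiveReps.
Variables (Q : quiver) (R : pzRingType).
Implicit Types X Y E : rep Q R.
Hypothesis rooted : right_rooted Q.

(** Named after the socle: the elements of [X v] killed by all arrows out of [v]. *)
Definition soc X v : {linear kermod (@psi Q R X v) -> X v} :=
  mklin (f := @ker_val R _ _ (@psi Q R X v)) (fun _ _ _ => erefl).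

Lemma soc_inj X v : injective (@soc X v).
Proof. by move=> x y; exact: val_inj. Qed.

Lemma soc_exact X v : exact_at (@soc X v) (@psi Q R X v).
Proof. by move=> y; split=> [/eqP e|[[x e] <-]]; [exists (Kermod e) | exact/eqP]. Qed.

Lemma split_injective_kernel (M N E : lmodType R) (f : {linear E -> M})
    (u : {linear N -> M}) :
  surj f -> injective_mod (kermod f) -> exists w : {linear N -> E}, forall x, f (w x) = u x.
Proof.
move=> fs inj.
pose i : {linear kermod f -> E} := mklin (f := @ker_val R _ _ f) (fun _ _ _ => erefl).
have ii : injective i by move=> x y; exact: val_inj.
have ie y : f y = 0 -> exists x, i x = y by move=> /eqP fy; exists (Kermod fy).
have fi x : f (i x) = 0 by case: x => x e; exact/eqP.
have [r rP] := inj _ _ i (mklin (f := id) (fun _ _ _ => erefl)) ii.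
have ker x : f x = 0 -> x - i (r x) = 0 by move=> /ie [y <-]; rewrite rP subrr.
have [w wP] := @factor_surj R _ _ _ f
  (mklin (f := id) (fun _ _ _ => erefl) \- (i \o r)) fs ker.
exists (w \o u) => x /=; have [y <-] := fs (u x).
by rewrite wP /= linearB /= fi subr0.
Qed.

(** At [v], lift the maps already built at the targets through the split surjection [psi]; the
    difference from [g] on [X v] lies in the kernel of [psi], and extends to [Y v] because that
    kernel is injective. *)
Lemma injective_rep_of_psi E :
  (forall v, surj (@psi Q R E v)) -> (forall v, injective_mod (kermod (@psi Q R E v))) ->
  injective_rep E.
Proof.
move=> ps pk X Y f g fm.
have [|h hP] := @rep_hom_rec Q rooted R Y E
  (fun v l => forall x, l (f v x) = g v x); last by exists h.
move=> v l lP.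
have [h0 h0P] := split_injective_kernel
  (prod_pair (fun a => l a \o (prod_proj _ a \o @psi Q R Y v))) (ps v) (pk v).
have d0 x : psi ((g v \- (h0 \o f v)) x) = 0.
  rewrite /= linearB h0P; apply: functional_extensionality_dep => a.
  rewrite -[LHS]/(psi (g v x) a - l a (psi (f v x) a)).
  by rewrite !psi_nat lP subrr.
have [k kP] := factor_inj (@soc_inj E v) (fun x => (soc_exact _).1 (d0 x)).
have [k' k'P] := pk v _ _ (f v) k (fm v).
exists (h0 \+ (@soc E v \o k')) => [x|x a].
  by rewrite -[LHS]/(h0 (f v x) + soc E v (k' (f v x))) k'P kP /= addrC subrK.
rewrite [psi _](linearD (@psi Q R E v) (h0 x) (soc E v (k' x))) h0P.
have e : psi (soc E v (k' x)) = 0 by apply/soc_exact; exists (k' x).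
by rewrite [X in _ + X]e addr0.
Qed.

Lemma kermod_psi_cofree (M : Q -> lmodType R) v :
  injective_mod (M v) -> injective_mod (kermod (@psi Q R (cofree M) v)).
Proof.
move=> Minj.
have [r rP] := factor_inj (i := @soc (cofree M) v) (g := @cofree_sub Q R M v)
  (@soc_inj _ _) (fun m => (soc_exact _).1 (psi_cofree_sub m)).
apply: (@injective_retract R (M v) _ (cofree_here M v \o @soc (cofree M) v) r) Minj.
move=> x; apply: soc_inj; rewrite rP /= -psi_cofree_eq0 //.
by apply/soc_exact; exists x.
Qed.

Lemma injective_cofree (M : Q -> lmodType R) :
  (forall v, injective_mod (M v)) -> injective_rep (cofree M).
Proof.
move=> Minj; apply: injective_rep_of_psi => v; first exact: psi_cofree_surj.
exact: kermod_psi_cofree.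
Qed.

Lemma injective_rep_embedding X :
  exists (M : Q -> lmodType R) (i : rep_hom X (cofree M)),
    (forall v, injective_mod (M v)) /\ rep_mono i.
Proof.
have [M /dep_choice [i iP]] := dep_choice (fun v => injective_embedding (X v)).
exists M, (to_cofree i); split=> v; first by case: (iP v).
by apply: to_cofree_mono => // w x _; apply: ker0_inj; case: (iP w).
Qed.

(** The properties of injective representations needed below pass to retracts, so this reduces them
    to cofree representations. *)
Lemma injective_rep_retract E :
  injective_rep E -> exists (M : Q -> lmodType R) (i : rep_hom E (cofree M))
    (r : rep_hom (cofree M) E),
    (forall v, injective_mod (M v)) /\ forall v x, r v (i v x) = x.
Proof.
move=> inj; have [M [i [Minj im]]] := injective_rep_embedding E.
by have [r rP] := inj _ _ i (rep_id E) im; exists M, i, r.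
Qed.

Lemma injective_rep_surj E v : injective_rep E -> surj (@psi Q R E v).
Proof.
move=> /injective_rep_retract [M [i [r [_ ri]]]] y.
have [x xP] := @psi_cofree_surj Q R M v (fun a => i (projT1 a) (y a)).
exists (r v x); apply: functional_extensionality_dep => a.
by rewrite psi_nat xP ri.
Qed.

Lemma injective_rep_at E v : injective_rep E -> injective_mod (E v).
Proof.
move=> /injective_rep_retract [M [i [r [Minj ri]]]].
by apply: (injective_retract (ri v)); apply: injective_modprod => p.
Qed.

Lemma injective_rep_soc E v : injective_rep E -> injective_mod (kermod (@psi Q R E v)).
Proof.
move=> /injective_rep_retract [M [i [r [Minj ri]]]].
have fn (X Y : rep Q R) (f : rep_hom X Y) x : psi ((f v \o @soc X v) x) = 0.
  apply: functional_extensionality_dep => a; rewrite psi_nat.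
  have -> : psi (soc X v x) = 0 by apply/soc_exact; exists x.
  exact: linear0.
have [i' i'P] := factor_inj (@soc_inj _ v) (fun x => (soc_exact _).1 (fn _ _ i x)).
have [r' r'P] := factor_inj (@soc_inj _ v) (fun x => (soc_exact _).1 (fn _ _ r x)).
apply: (@injective_retract R _ _ i' r') => [x|]; last exact: kermod_psi_cofree.
by apply: soc_inj; rewrite r'P [LHS](congr1 (r v) (i'P x)) /= ri.
Qed.

End InjectiveReps.

(** * Purity *)

Section TensorTerms.
Variables (Q : quiver) (R : pzRingType) (S : rep (op_quiver Q) R^c).
Implicit Types X Y Z : rep Q R.

(** [rho] is any family of functions, neither linear nor natural, so that derivations can be
    transported along maps of sets. *)
Fixpoint tens_term_map X Y (rho : forall i, X i -> Y i) (t : tens_term S X) :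
    tens_term S Y :=
  match t with
  | TZero => TZero S Y
  | TOpp t => TOpp (tens_term_map rho t)
  | TAdd t u => TAdd (tens_term_map rho t) (tens_term_map rho u)
  | TGen i s x => @TGen Q R S Y i s (rho i x)
  end.

Lemma tensor_map_class X Y (f : rep_hom X Y) (t : tens_term S X) :
  tensor_map S f (tens_class t) = tens_class (tens_term_map (fun i => f i) t).
Proof.
elim: t => [|t IH|t IHt u IHu|i s x] /=; last exact: tensor_mapE.
- by rewrite !tens_class0 raddf0.
- by rewrite !tens_classN raddfN IH.
- by rewrite !tens_classD raddfD IHt IHu.
Qed.

Lemma tensor_map_comp X Y Z (f : rep_hom X Y) (g : rep_hom Y Z) (h : rep_hom X Z) :
  (forall i x, g i (f i x) = h i x) ->
  forall t, tensor_map S g (tensor_map S f t) = tensor_map S h t.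
Proof.
move=> gf; elim/tens_ind; elim=> [|t IH|t IHt u IHu|i s x].
- by rewrite tens_class0 !raddf0.
- by rewrite tens_classN !raddfN IH.
- by rewrite tens_classD !raddfD IHt IHu.
- by rewrite !tensor_mapE gf.
Qed.

Section RightExact.
Variables (X Y Z : rep Q R) (f : rep_hom X Y) (g : rep_hom Y Z).
Hypotheses (fg : rep_exact f g) (g_epi : rep_epi g).

Let im (u : tensor S Y) := exists w, tensor_map S f w = u.

Let im0 : im 0. Proof. by exists 0; rewrite raddf0. Qed.
Let imD u v : im u -> im v -> im (u + v).
Proof. by move=> [x <-] [y <-]; exists (x + y); rewrite raddfD. Qed.
Let imN u : im u -> im (- u).
Proof. by move=> [x <-]; exists (- x); rewrite raddfN. Qed.

Let im_gen i (s : S i) (y : Y i) : g i y = 0 -> im (tgen s y).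
Proof. by move=> /(fg (i := i)) [x <-]; exists (tgen s x); rewrite tensor_mapE. Qed.

Let im_genB i (s : S i) (y z : Y i) : g i y = g i z -> im (tgen s y - tgen s z).
Proof.
move=> e; have -> : tgen s y - tgen s z = tgen s (y - z).
  by apply/eqP; rewrite subr_eq -tgenDr subrK.
by apply: im_gen; rewrite linearB e subrr.
Qed.

(* A derivation of [t = u] over [Z] is lifted along a set-theoretic section of
   [g]; each step holds up to the image of [f]. *)
Let im_lift (l : forall i, Z i -> Y i) (lP : forall i z, g i (l i z) = z)
    (t u : tens_term S Z) : tens_eq t u ->
  im (tens_class (tens_term_map l t) - tens_class (tens_term_map l u)).
Proof.
elim=> {t u} /=.
- by move=> t; rewrite subrr.
- by move=> t u _ /imN; rewrite opprB.
- move=> t u w _ IH _ IH'; have := imD IH IH'.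
  by rewrite addrA subrK.
- by move=> t u _ /imN; rewrite !tens_classN opprD.
- move=> t t' u u' _ IH _ IH'; have := imD IH IH'.
  by rewrite !tens_classD opprD addrACA.
- by move=> t u w; rewrite !tens_classD addrA subrr.
- by move=> t u; rewrite !tens_classD [X in X - _]addrC subrr.
- by move=> t; rewrite tens_classD tens_class0 add0r subrr.
- by move=> t; rewrite tens_classD tens_classN addNr tens_class0 subrr.
- move=> i s s' x; rewrite tens_classD -![tens_class (TGen _ _)]/(tgen _ _).
  by rewrite tgenDl subrr.
- move=> i s x x'; rewrite tens_classD -![tens_class (TGen _ _)]/(tgen _ _).
  by rewrite -tgenDr; apply: im_genB; rewrite linearD !lP.
- move=> i r s x; rewrite -![tens_class (TGen _ _)]/(tgen _ _).
  by rewrite tgenZ; apply: im_genB; rewrite linearZ /= !lP.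
- move=> i j a s x; rewrite -[tens_class _]/(@tgen Q R S Y i (@rep_map _ _ S j i a s) (l i x)).
  rewrite -[X in _ - X]/(@tgen Q R S Y j s (l j (rep_map Z a x))).
  by rewrite tgenMap; apply: im_genB; rewrite hom_nat !lP.
Qed.

(** If the image of [t] vanishes over [Z], [im_lift] lifts the derivation to [Y], and [lift_g]
    compares [t] with its round trip through [Z]. *)
Lemma tensor_right_exact :
  exact_at (tensor_map S f) (tensor_map S g) /\ surj (tensor_map S g).
Proof.
have [l lP] := dep_choice (fun i => dep_choice (@g_epi i)).
have lift_g (t : tens_term S Y) :
    im (tens_class t - tens_class (tens_term_map l (tens_term_map (fun i => g i) t))).
  elim: t => [|t IH|t IHt u IHu|i s x] /=.
  - by rewrite subrr.
  - by rewrite !tens_classN -opprD; apply: imN.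
  - by rewrite !tens_classD opprD addrACA; apply: imD.
  - by apply: im_genB; rewrite lP.
split; last first.
  elim/tens_ind; elim=> [|t [x IH]|t [x IHt] u [y IHu]|i s z].
  - by exists 0; rewrite raddf0.
  - by exists (- x); rewrite raddfN IH tens_classN.
  - by exists (x + y); rewrite raddfD IHt IHu tens_classD.
  - by exists (tgen s (l i z)); rewrite tensor_mapE lP.
elim/tens_ind => t; split=> [|[x <-]].
  rewrite tensor_map_class -tens_class0 => /tens_classP /(im_lift lP) /=.
  rewrite tens_class0 subr0 => h; have := imD (lift_g t) h.
  by rewrite subrK.
move: x; elim/tens_ind; elim=> [|u IH|u IHu w IHw|i s x].
- by rewrite tens_class0 !raddf0.
- by rewrite tens_classN !raddfN IH oppr0.
- by rewrite tens_classD !raddfD IHu IHw addr0.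
- rewrite !tensor_mapE; have -> : g i (f i x) = 0 by apply/fg; exists x.
  exact: raddf0.
Qed.

End RightExact.

End TensorTerms.

(** * Pure and locally split monomorphisms *)

Section Purity.
Variables (Q : quiver) (R : pzRingType).
Implicit Types X Y Z W K : rep Q R.

Definition pure_mono X Y (f : rep_hom X Y) :=
  forall S : rep (op_quiver Q) R^c, injective (tensor_map S f).

(** Right exactness of the tensor product leaves only injectivity on the left to check. *)
Lemma pure_ses_mono X Y Z (f : rep_hom X Y) (g : rep_hom Y Z) :
  short_exact f g -> pure_mono f -> pure_ses f g.
Proof.
move=> se fp; split=> // S; case: se => _ fg ge.
by have [e s] := tensor_right_exact S fg ge; split.
Qed.

Lemma pure_mono_comp X Y Z (f : rep_hom X Y) (g : rep_hom Y Z) (h : rep_hom X Z) :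
  (forall i x, g i (f i x) = h i x) -> pure_mono h -> pure_mono f.
Proof.
move=> gf hp S x y e; apply: (hp S).
by rewrite -!(tensor_map_comp gf) e.
Qed.

Lemma pure_mono_image X K Y (f : rep_hom X Y) (k : rep_hom K Y) :
  rep_mono f -> rep_mono k ->
  (forall i y, (exists x, f i x = y) <-> (exists x, k i x = y)) ->
  pure_mono f -> pure_mono k.
Proof.
move=> fm km fk fp S.
have [t tP] := rep_factor_mono fm (g := k) (fun i x => (fk i _).2 (ex_intro _ x erefl)).
have [u uP] := rep_factor_mono km (g := f) (fun i x => (fk i _).1 (ex_intro _ x erefl)).
have ut i x : u i (t i x) = rep_id K i x by apply: km; rewrite uP tP.
have idE z : tensor_map S (rep_id K) z = z.
  move: z; elim/tens_ind; elim=> [|v IH|v IHv w IHw|i s x].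
  - by rewrite tens_class0 !raddf0.
  - by rewrite tens_classN !raddfN IH.
  - by rewrite tens_classD !raddfD IHv IHw.
  - by rewrite tensor_mapE.
move=> x y; rewrite -!(tensor_map_comp tP) => /fp e.
by rewrite -[x]idE -[y]idE -!(tensor_map_comp ut) e.
Qed.

(** A single equation from the system that defines a retraction from [Y] to [X]. *)
Inductive rep_fact X Y :=
| FAdd i of Y i & Y i
| FScale i of R & Y i
| FMap (i j : Q) of arrow i j & Y i
| FFix i of X i.

Definition respects X Y (f : rep_hom X Y) (rho : forall i, Y i -> X i)
    (F : rep_fact X Y) : Prop :=
  match F with
  | FAdd i y y' => rho i (y + y') = rho i y + rho i y'
  | FScale i r y => rho i (r *: y) = r *: rho i y
  | FMap i j a y => rho j (rep_map Y a y) = rep_map X a (rho i y)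
  | FFix i x => rho i (f i x) = x
  end.

(* Any finitely many of the equations defining a retraction of [f] can be
   solved by a map of sets; a derivation that a tensor vanishes over [Y] only
   uses finitely many of them, so it can be carried over to [X]. *)
Definition locally_split X Y (f : rep_hom X Y) :=
  forall L : seq (rep_fact X Y),
  exists rho, forall F, List.In F L -> respects f rho F.

Lemma locally_split_pure X Y (f : rep_hom X Y) : locally_split f -> pure_mono f.
Proof.
move=> ls S.
have inl (L L' : seq (rep_fact X Y)) F : List.In F L -> List.In F (L ++ L').
  by move=> h; apply: List.in_or_app; left.
have inr (L L' : seq (rep_fact X Y)) F : List.In F L' -> List.In F (L ++ L').
  by move=> h; apply: List.in_or_app; right.
have deriv (t u : tens_term S Y) : tens_eq t u -> exists L, forall rho,
    (forall F, List.In F L -> respects f rho F) ->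
    tens_eq (tens_term_map rho t) (tens_term_map rho u).
  elim=> {t u} /=.
  - by move=> t; exists [::] => rho _; apply: TRefl.
  - by move=> t u _ [L IH]; exists L => rho /IH; apply: TSym.
  - move=> t u w _ [L IH] _ [L' IH']; exists (L ++ L') => rho h.
    by apply: (@TTrans _ _ _ _ _ (tens_term_map rho u)); [apply: IH|apply: IH'];
       move=> F hF; apply: h; [apply: inl|apply: inr].
  - by move=> t u _ [L IH]; exists L => rho /IH; apply: TCongOpp.
  - move=> t t' u u' _ [L IH] _ [L' IH']; exists (L ++ L') => rho h.
    by apply: TCongAdd; [apply: IH|apply: IH'];
       move=> F hF; apply: h; [apply: inl|apply: inr].
  - by move=> t u w; exists [::] => rho _; apply: TAddA.
  - by move=> t u; exists [::] => rho _; apply: TAddC.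
  - by move=> t; exists [::] => rho _; apply: TAdd0.
  - by move=> t; exists [::] => rho _; apply: TAddN.
  - by move=> i s s' x; exists [::] => rho _; apply: TGenDl.
  - move=> i s x x'; exists [:: FAdd X x x'] => rho h.
    by rewrite (h _ (or_introl erefl)); apply: TGenDr.
  - move=> i r s x; exists [:: FScale X r x] => rho h.
    by rewrite (h _ (or_introl erefl)); apply: TGenZ.
  - move=> i j a s x; exists [:: FMap X a x] => rho h.
    by rewrite (h _ (or_introl erefl)); apply: TGenMap.
have fixed (t : tens_term S X) : exists L, forall rho,
    (forall F, List.In F L -> respects f rho F) ->
    tens_term_map rho (tens_term_map (fun i => f i) t) = t.
  elim: t => [|t [L IH]|t [L IH] u [L' IH']|i s x] /=.
  - by exists [::].
  - by exists L => rho /IH ->.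
  - exists (L ++ L') => rho h; rewrite IH ?IH' // => F hF; apply: h.
      exact: inr.
    exact: inl.
  - exists [:: FFix Y x] => rho h.
    by rewrite (h _ (or_introl erefl)).
elim/tens_ind => t; elim/tens_ind => u; rewrite !tensor_map_class.
move=> /tens_classP /deriv [L LP]; have [Lt LtP] := fixed t; have [Lu LuP] := fixed u.
have [rho rhoP] := ls (L ++ (Lt ++ Lu)).
have et := LtP rho (fun F hF => rhoP F (inr _ _ F (inl _ _ F hF))).
have eu := LuP rho (fun F hF => rhoP F (inr _ _ F (inr _ _ F hF))).
apply/tens_classP; rewrite -et -eu.
by apply: LP => F hF; apply/rhoP/inl.
Qed.

End Purity.

(** * Strongly fp-injective representations *)

Lemma finite_set_list (T : Type) :
  finite_set [set: T] -> exists s : seq T, forall x, List.In x s.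
Proof.
move=> [n /card_bijP [f /bij_inj fi]].
have [g [gi gn]] : exists g : T -> nat, injective g /\ forall x, (g x < n)%N.
  have Tx (x : T) : x \in [set: T]%classic by exact: in_setT.
  exists (fun x => val (f (SigSub (Tx x)))); split=> [x y e|x].
    exact: (congr1 val (fi _ _ (val_inj e))).
  exact: (set_mem (valP (f (SigSub (Tx x))))).
have [s sP] : exists s : seq T, forall x, (g x < n)%N -> List.In x s.
  elim: n {f fi gn} => [|n [s sP]]; first by exists [::].
  have [[x fx]|nex] := pselect (exists x, g x = n).
    exists (x :: s) => y; rewrite ltnS leq_eqVlt => /orP [/eqP fy|/sP]; last by right.
    by left; apply: gi; rewrite fx.
  exists s => y; rewrite ltnS leq_eqVlt => /orP [/eqP fy|/sP //].
  by case: nex; exists y.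
by exists s => x; apply: sP.
Qed.

(** Induction from the sinks: finitely many first arrows, each followed by finitely many paths. *)
Lemma finite_paths (Q : quiver) :
  right_rooted Q -> locally_target_finite Q ->
  forall v : Q, exists s : seq (path_from v), forall p, List.In p s.
Proof.
move=> rooted fin; apply: (successor_ind rooted) => v /dep_choice [s sP].
have [l lP] := finite_set_list (fin v).
exists (here :: List.flat_map (fun a => List.map (step (projT2 a)) (s a)) l).
move=> [|w a q]; first by left.
right; apply/List.in_flat_map; exists (existT _ w a); split; first exact: lP.
by apply: List.in_map; apply: (sP (existT _ w a)).
Qed.

Section LocallySplit.
Variable R : pzRingType.

Inductive mod_fact (Z E : lmodType R) :=
| MAdd of E & E
| MScale of R & E
| MFix of Z.

Definition mod_respects (Z E : lmodType R) (i : {linear Z -> E}) (rho : E -> Z)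
    (F : mod_fact Z E) : Prop :=
  match F with
  | MAdd y y' => rho (y + y') = rho y + rho y'
  | MScale r y => rho (r *: y) = r *: rho y
  | MFix z => rho (i z) = z
  end.

(** The equations in [L] form a finite linear system with constants in [Z], whose unknowns are the
    values of [rho] at the elements [s] that occur. The elements themselves solve it in [E], so it
    is consistent, and fp-injectivity solves it in [Z]. *)
Lemma fp_injective_locally_split (Z E : lmodType R) (i : {linear Z -> E})
    (L : seq (mod_fact Z E)) :
  injective i -> fp_injective_mod Z ->
  exists rho, forall F, List.In F L -> mod_respects i rho F.
Proof.
move=> ii inj.
pose elems (F : mod_fact Z E) : seq E := match F with
  | MAdd y y' => [:: y + y'; y; y']
  | MScale r y => [:: r *: y; y]
  | MFix z => [:: i z] end.
pose s := flatten [seq elems F | F <- L].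
(* The basis vector of the unknown at [e], or zero if [e] is not in [s]. *)
pose dl (e : E) : 'rV[R]_(size s) := \row_(j < size s) (j == index e s :> nat)%:R.
pose p := lincomb (fun j : 'I_(size s) => s`_j).
have pdl e : e \in s -> p (dl e) = e.
  move=> es; have lt : (index e s < size s)%N by rewrite index_mem.
  rewrite /= (bigD1 (Ordinal lt)) //= big1 => [|j].
    by rewrite mxE eqxx scale1r addr0 nth_index.
  by rewrite mxE -val_eqE /= => /negbTE ->; rewrite scale0r.
pose row (F : mod_fact Z E) : 'rV[R]_(size s) := match F with
  | MAdd y y' => dl (y + y') - (dl y + dl y')
  | MScale r y => dl (r *: y) - r *: dl y
  | MFix z => dl (i z) end.
pose val (F : mod_fact Z E) : Z := if F is MFix z then z else 0.
have subs F : List.In F L -> {subset elems F <= s}.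
  rewrite /s; elim: (L) => //= G L' IH [->|/IH h] e eF; rewrite mem_cat ?eF //.
  by rewrite h ?orbT.
have prow F : List.In F L -> p (row F) = i (val F).
  move=> /subs; case: F => [y y'|r y|z] h; rewrite ?linear0.
  - rewrite [row _]/= linearB linearD !pdl ?subrr //; apply: h; rewrite !inE eqxx ?orbT //.
  - by rewrite [row _]/= linearB linearZ !pdl ?subrr //; apply: h; rewrite !inE eqxx ?orbT.
  - by rewrite [row _]/= pdl //; apply: h; rewrite !inE eqxx.
pose F0 : mod_fact Z E := MFix E 0.
have nthL (k : 'I_(size L)) : List.In (nth F0 L k) L.
  case: k => k /=; elim: (L) k => // G L' IH [|k] /= kL; first by left.
  by right; apply: IH.
have Lnth F : List.In F L -> exists k : 'I_(size L), nth F0 L k = F.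
  elim: (L) => //= G L' IH [->|/IH [k <-]]; first by exists ord0.
  by exists (lift ord0 k).
pose q := lincomb (fun k : 'I_(size L) => row (nth F0 L k)).
pose g := lincomb (fun k : 'I_(size L) => val (nth F0 L k)).
have pq x : p (q x) = i (g x).
  apply: (row_linear_ext (f := p \o q) (g := i \o g)) => k.
  rewrite -[LHS]/(p (q (unit_row R k))) -[RHS]/(i (g (unit_row R k))).
  by rewrite !lincomb_unit prow.
have [|h hP] := inj _ _ q g.
  by move=> x qx; apply: ii; rewrite -pq qx !linear0.
have hrow F : List.In F L -> h (row F) = val F.
  by move=> /Lnth [k <-]; have := hP (unit_row R k); rewrite !lincomb_unit.
exists (fun e => h (dl e)) => F /hrow; case: F => [y y'|r y|z] //= /eqP.
  by rewrite linearB linearD subr_eq0 => /eqP.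
by rewrite linearB linearZ subr_eq0 => /eqP.
Qed.

Variable Q : quiver.
Hypothesis paths : forall v : Q, exists s : seq (path_from v), forall p, List.In p s.

(** An equation at [v] splits into one for each of the finitely many paths from [v], solved at the
    end of the path; equations for arrows hold because [rho] acts componentwise. *)
Lemma cofree_locally_split (Z E : Q -> lmodType R) (i : forall v, {linear Z v -> E v}) :
  (forall v, injective (i v)) -> (forall v, fp_injective_mod (Z v)) ->
  locally_split (cofree_hom i).
Proof.
move=> ii inj L.
pose T := {v : Q & mod_fact (Z v) (E v)}.
pose at_path (v : Q) (p : path_from v) F : T := existT _ (path_end p) F.
pose covers (G : seq T) (F : rep_fact (cofree Z) (cofree E)) : Prop := match F with
  | FAdd v y y' => forall p, List.In (@at_path v p (MAdd _ (y p) (y' p))) G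
  | FScale v r y => forall p, List.In (@at_path v p (MScale _ r (y p))) G
  | FMap _ _ _ _ => True
  | FFix v z => forall p, List.In (@at_path v p (MFix _ (z p))) G end.
have [G GP] : exists G, forall F, List.In F L -> covers G F.
  elim: L => [|F L [G GP]]; first by exists [::].
  have [H HF] : exists H, covers H F.
    case: F => [v y y'|v r y|u v a y|v z] /=; last 2 first.
    - by exists [::].
    - have [s sP] := paths v.
      exists (List.map (fun p => at_path v p (MFix _ (z p))) s) => p.
      exact: (List.in_map (fun p => at_path v p (MFix _ (z p)))).
    - have [s sP] := paths v.
      exists (List.map (fun p => at_path v p (MAdd _ (y p) (y' p))) s) => p.
      exact: (List.in_map (fun p => at_path v p (MAdd _ (y p) (y' p)))).
    - have [s sP] := paths v.
      exists (List.map (fun p => at_path v p (MScale _ r (y p))) s) => p.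
      exact: (List.in_map (fun p => at_path v p (MScale _ r (y p)))).
  exists (H ++ G) => F' [<-|/GP].
    by case: F HF => [v y y'|v r y|u v a y|v z] //= h p; apply: List.in_or_app; left.
  by case: F' => [v y y'|v r y|u v a y|v z] //= h p; apply: List.in_or_app; right.
have /dep_choice [rho rhoP] v : exists rho : E v -> Z v,
    forall F, List.In (existT _ v F : T) G -> mod_respects (i v) rho F.
  have [Lv LvP] : exists Lv, forall F, List.In (existT _ v F : T) G -> List.In F Lv.
    elim: G {GP} => [|[w F] G [Lv LvP]]; first by exists [::].
    have [e|ne] := pselect (w = v); last first.
      by exists Lv => F' [[/ne]|/LvP].
    subst w; exists (F :: Lv) => F' [|/LvP]; last by right.
    by move=> /(Eqdep.EqdepTheory.inj_pair2 _ _ _ _ _); left.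
  have [rho rhoP] := fp_injective_locally_split Lv (@ii v) (inj v).
  by exists rho => F /LvP /rhoP.
exists (fun v (y : cofree E v) p => rho (path_end p) (y p)) => F /GP.
case: F => [v y y'|v r y|u v a y|v z] //= h;
  apply: functional_extensionality_dep => p; exact: (rhoP _ _ (h p)).
Qed.

End LocallySplit.

Section StronglyFpInjectiveReps.
Variables (Q : quiver) (R : pzRingType).
Implicit Types X Y Z W : rep Q R.

(** Splices the short exact sequences obtained by iterating [nextP] into a pure injective
    coresolution. *)
Lemma strongly_fp_injective_rep_coind (P : rep Q R -> Prop) :
  (forall W, P W -> exists W', P W' /\
     exists I (i : rep_hom W I) (p : rep_hom I W'),
       [/\ injective_rep I, short_exact i p & pure_mono i]) ->
  forall W, P W -> strongly_fp_injective_rep W.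
Proof.
move=> nextP W PW.
have next (s : {W | P W}) : {t : {W | P W} | exists I (i : rep_hom (sval s) I)
    (p : rep_hom I (sval t)), [/\ injective_rep I, short_exact i p & pure_mono i]}.
  by case: s => V PV; apply: cid; have [W' [PW' h]] := nextP V PV; exists (exist _ W' PW').
pose S n := iter n (fun s => sval (next s)) (exist _ W PW).
have [I /dep_choice [i /dep_choice [p ipP]]] := dep_choice (fun n => svalP (next (S n))).
pose T n : rep Q R := sval (S n).
have {}ipP n : [/\ injective_rep (I n), @short_exact _ _ (T n) _ (T n.+1) (i n) (p n)
    & pure_mono (i n)] by exact: ipP.
have m n : rep_mono (i n) by case: (ipP n) => _ [].
have ex n : rep_exact (i n) (p n) by case: (ipP n) => _ [].
have ep n : rep_epi (p n) by case: (ipP n) => _ [].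
pose d n : rep_hom (I n) (I n.+1) := @rep_comp _ _ (I n) (T n.+1) (I n.+1) (i n.+1) (p n).
have kd n v y : d n v y = 0 <-> exists x, i n v x = y.
  rewrite -(ex n v y); split=> [/(ker0_inj (@m n.+1 v)) //|py].
  by rewrite /= py linear0.
exists I, (i 0%N), d; split; first by move=> n; case: (ipP n).
split=> [|[|n] v y|[|n] K J k q j [km kq qe] jm jq].
- exact: m.
- exact: kd.
- split=> [/kd [z <-]|[x <-]]; last by apply/kd; exists (p n v x).
  by have [x <-] := ep n v z; exists x.
(* In degree [0] the differential is mono, so [K] is zero and the zero map is a retraction. *)
- apply: pure_ses_mono => //; apply: locally_split_pure => L.
  exists (fun v y => 0) => F _; case: F => [v y y'|v r y|u v a y|v z] /=.
  + by rewrite addr0.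
  + by rewrite scaler0.
  + by rewrite linear0.
  + apply: (km v); rewrite linear0; apply: (m 0%N v); rewrite linear0.
    have := jq v (k v z); have -> : q v (k v z) = 0 by apply/kq; exists z.
    by rewrite linear0.
- apply: pure_ses_mono => //; apply: (pure_mono_image (m n) km); last by case: (ipP n).
  move=> v y; rewrite -(kd n v y) -(kq v y) -[d n v y]/(d n v y) -jq.
  by split=> [/(ker0_inj (@jm v)) //|->]; rewrite linear0.
Qed.

(** The pure embedding of [X] into the injective [E 0] extends along [f], and a first factor of a
    pure monomorphism is pure. *)
Lemma strongly_fp_injective_rep_fp X :
  strongly_fp_injective_rep X -> fp_injective_rep X.
Proof.
move=> [E [e [d [Einj [em ex pu]]]]] Y Z f g [fm fg ge].
apply: pure_ses_mono => //; have [h hP] := Einj 0%N X Y f e fm.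
apply: (pure_mono_comp hP); have [C [p [pe ep]]] := rep_coker_exists e.
have dp i x : p i x = 0 -> d 0%N i x = 0 by move=> /(ep i) [z <-]; apply/(ex 0%N); exists z.
have [m mP] := rep_factor_epi pe dp.
have mm : rep_mono m.
  move=> i; apply: inj_ker0 => c; have [y <-] := pe i c.
  by rewrite mP => /(ex 0%N) [x <-]; apply/(ep i); exists x.
(* Degree [1] of the coresolution, where [X] is the kernel of the map from [E 0] to [E 1]. *)
by have [_ h'] := pu 1%N X C e p m (And3 em ep pe) mm mP; move=> S; case: (h' S).
Qed.

(** Injective embeddings of the [J v] have fp-injective cokernels by coherence, so the cofree
    sequence they induce can be iterated; finiteness of the path sets makes it pure. *)
Lemma strongly_fp_injective_cofree (J : Q -> lmodType R) :
  right_rooted Q -> locally_target_finite Q -> kernels_fin_generated R ->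
  (forall v, fp_injective_mod (J v)) -> strongly_fp_injective_rep (cofree J).
Proof.
move=> rooted fin coh Jinj.
apply: (@strongly_fp_injective_rep_coind (fun W => exists2 J, W = cofree J &
  forall v : Q, fp_injective_mod (J v))); last by exists J.
move=> _ [{Jinj} {}J -> Jinj].
have [E /dep_choice [C /dep_choice [i /dep_choice [p ipP]]]] :=
  dep_choice (fun v => injective_ses (J v)).
exists (cofree C); split.
  exists C => // v; have [Einj ii ip ps] := ipP v.
  exact: (fp_injective_coker (Jinj v) ii ip ps Einj).
have ii v : injective (i v) by case: (ipP v).
have ip v : exact_at (i v) (p v) by case: (ipP v).
exists (cofree E), (cofree_hom i), (cofree_hom p); split.
- by apply: injective_cofree => // v; case: (ipP v).
- split=> v.
  + apply: inj_ker0 => x x0; apply: functional_extensionality_dep => q.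
    by apply: ii; rewrite linear0; exact: (congr1 (fun F : cofree_ob E v => F q) x0).
  + move=> y; split=> [py|[x <-]].
      have h q : p _ (y q) = 0 by exact: (congr1 (fun F : cofree_ob C v => F q) py).
      have [x xP] := dep_choice (fun q => (ip _ _).1 (h q)).
      by exists x; apply: functional_extensionality_dep.
    by apply: functional_extensionality_dep => q; apply/ip; exists (x q).
  + move=> z; have ps w : surj (p w) by case: (ipP w).
    have [y yP] := dep_choice (fun q : path_from v => ps _ (z q)).
    by exists y; apply: functional_extensionality_dep.
- by apply: locally_split_pure; apply: cofree_locally_split => //; exact: finite_paths.
Qed.

End StronglyFpInjectiveReps.

Lemma tgen0l (Q : quiver) (R : pzRingType) (S : rep (op_quiver Q) R^c)
  (X : rep Q R) (v : Q) (x : X v) : tgen (0 : S v) x = 0.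
Proof. by apply: (addrI (tgen 0 x)); rewrite -tgenDl !addr0. Qed.

Lemma tgen_suml (Q : quiver) (R : pzRingType) (S : rep (op_quiver Q) R^c)
    (X : rep Q R) (v : Q) (I : Type) (r : seq I) (s : I -> S v) (x : X v) :
  tgen (\sum_(k <- r) s k) x = \sum_(k <- r) tgen (s k) x.
Proof.
by elim/big_rec2: _ => [|k t u _ <-]; [exact: tgen0l | exact: tgenDl].
Qed.

(* With [S = Hom(J, D)], purity of [J -> E] extends the evaluation
   [S (x) J -> D] to [S (x) E], so that each character of [J v] extends to
   [E v], compatibly with linear equations. If a finite system with constants in
   [J v] is solvable in [E v] but not in [J v], then a character of a power of
   [J v] separates its constants from the solvable ones, a contradiction. *)
Lemma fp_injective_rep_at (Q : quiver) (R : pzRingType) (J : rep Q R) (v : Q) :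
  right_rooted Q -> fp_injective_rep J -> fp_injective_mod (J v).
Proof.
move=> rooted Jfp m n q g qg.
have [D [Ddiv Dtor]] := divisible_torsion_exists.
have [M [i [Minj im]]] := injective_rep_embedding rooted J.
have [C [p [pe ip]]] := rep_coker_exists i.
have [_ /(_ (hom_rep J D)) [Ti _ _]] := Jfp _ _ i p (And3 im ip pe).
set S := hom_rep J D in Ti.
pose ev : {additive tensor S J -> D} := tens_lift (rep_id S : rep_hom S (hom_rep J D)).
have evE (s : S v) (x : J v) : ev (tgen s x) = zhom_app s x by exact: tens_liftE.
have [eps epsP] := divisible_extend Ddiv ev Ti.
have epsE (s : S v) (x : J v) : eps (tgen s (i v x)) = zhom_app s x.
  by rewrite -evE -epsP tensor_mapE.
have Einj : injective_mod (cofree M v) by apply: injective_modprod.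
have [e eP] := injective_extend_ker (f := q) (g := i v \o g) Einj
  (fun x qx => etrans (congr1 (i v) (qg x qx)) (linear0 (i v))).
apply: contrapT => no.
pose B := modprod (fun _ : 'I_m => J v).
pose A (x : B) := exists h : {linear 'rV[R]_n -> J v}, forall k, h (q (unit_row R k)) = x k.
pose b : B := fun k => g (unit_row R k).
have nAb : ~ A b.
  by move=> [h hP]; apply: no; exists h; apply: (row_linear_ext (f := h \o q)).
have A0 : A 0.
  by exists (lincomb (fun _ => 0)) => k /=; rewrite big1 // => j _; rewrite scaler0.
have AB x y : A x -> A y -> A (x - y).
  by move=> [h hP] [h' h'P]; exists (h \- h') => k; rewrite /= hP h'P.
have [chi [chiA chib]] := separate_subgroup Ddiv Dtor A0 AB nAb.
pose inc k (x : J v) : B := fun l => if l == k then x else 0.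
have inc_add k : zmod_morphism (chi \o inc k).
  move=> x y; rewrite /= -raddfB; congr (chi _).
  apply: functional_extensionality_dep => l; rewrite -[RHS]/(inc k x l - inc k y l) /inc.
  by case: ifP; rewrite ?subrr.
pose ch k : {additive J v -> D} := HB.pack (chi \o inc k)
  (GRing.isZmodMorphism.Build (J v) D (chi \o inc k) (inc_add k)).
pose c k : S v := ch k.
have chiE (x : B) : chi x = \sum_k zhom_app (c k) (x k).
  rewrite -[RHS]/(\sum_k chi (inc k (x k))) -raddf_sum; congr (chi _).
  apply: functional_extensionality_dep => l.
  rewrite -[RHS]/(prod_proj _ l (\sum_k inc k (x k))) linear_sum (bigD1 l) //=.
  by rewrite /inc eqxx big1 ?addr0 // => k /negbTE kl; rewrite eq_sym kl.
pose a k j : R := q (unit_row R k) 0 j.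
(* [chi] vanishes on solvable systems, and the multiples of [x] by column [j] of [q] form one: send
   the [j]-th unknown to [x]. *)
have rel j : \sum_k (a k j : R^c) *: c k = 0.
  apply: additive_ext => x.
  transitivity (chi (fun k => a k j *: x)).
    rewrite chiE -[LHS]/(zhom_app (\sum_k (a k j : R^c) *: c k) x).
    have appD : {morph (fun f : zhom (J v) D => zhom_app f x) : f g / f + g} by [].
    by rewrite (big_morph _ appD erefl).
  apply: chiA; exists (lincomb (fun j' => if j' == j then x else 0)) => k /=.
  by rewrite (bigD1 j) //= eqxx big1 ?addr0 // => j' /negbTE ->; rewrite scaler0.
apply: chib; rewrite chiE.
(* Expand the solution [e] in [cofree M v] along [q] and move the coefficients to the characters,
   where [rel] applies. *)
transitivity (\sum_k \sum_j eps (tgen ((a k j : R^c) *: c k) (e (unit_row R j)))).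
  apply: eq_bigr => k _; rewrite -epsE -[i v _]/((i v \o g) (unit_row R k)) -eP.
  rewrite (row_linear_sum e) raddf_sum raddf_sum; apply: eq_bigr => j _.
  by rewrite tgenZ.
rewrite exchange_big big1 // => j _.
by rewrite -raddf_sum -tgen_suml rel tgen0l raddf0.
Qed.

(** * Gorenstein modules and representations *)

Section GorensteinModules.
Variable R : pzRingType.
Implicit Types N J Y Z : lmodType R.

(* [Ext^1(J, N) = 0], read on the extension of [im p] by [N]. *)
Lemma gorenstein_lift N Y Z J (j : {linear N -> Y}) (p : {linear Y -> Z})
    (u : {linear J -> Z}) :
  gorenstein_strongly_fp_injective_mod N -> strongly_fp_injective_mod J ->
  injective j -> exact_at j p -> (forall x, exists y, p y = u x) ->
  exists w : {linear J -> Y}, forall x, p (w x) = u x.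
Proof.
move=> [E [d [Einj dex dHom [k [ki kd]]]]] HJ ji jp pu.
have [e eP] := Einj 0 N Y j k ji.
have de y y' : p y = p y' -> d 0 (e y) = d 0 (e y').
  move=> /eqP; rewrite -subr_eq0 -linearB => /eqP /jp [z zP].
  by apply: subr0_eq; rewrite -!linearB -zP eP; apply/kd; exists z.
(* Preimages of [u x] differ by [N], which [d 0] kills, so [d 0 (e y)] is a well-defined linear
   function of [x]. *)
have [x|x t t' [y py ->] [y' py' ->]|a x x' t t' [y py ->] [y' py' ->]|t tP] :=
  @linear_choice R J (E (0 + 1)) (fun x t => exists2 y, p y = u x & t = d 0 (e y)).
- by have [y py] := pu x; exists (d 0 (e y)), y.
- by apply: de; rewrite py py'.
- by exists (a *: y + y'); rewrite !linearP ?py ?py'.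
have [w wP] : exists w : {linear J -> E 0}, forall x, d 0 (w x) = t x.
  apply: (dHom J HJ 0 t).1 => x; have [y _ ->] := tP x.
  by apply/dex; exists (e y).
(* Exactly one preimage [y] of [u x] has [e y = w x]: the freedom of choice is [N], on which [e] is
   the embedding [k]. *)
have [x|x y y'|a x x' y y'|v vP] :=
  @linear_choice R J Y (fun x y => p y = u x /\ e y = w x); last first.
- by exists v => x; case: (vP x).
- by move=> [py ey] [py' ey']; rewrite !linearP py py' ey ey'.
- move=> [py ey] [py' ey']; apply: subr0_eq.
  have /jp [z zP] : p (y - y') = 0 by rewrite linearB py py' subrr.
  rewrite -zP; suff -> : z = 0 by rewrite linear0.
  by apply: ki; rewrite -eP zP linear0 linearB ey ey' subrr.
- have [y py ty] := tP x.
  have /kd [z zP] : d 0 (e y - w x) = 0 by rewrite linearB wP ty subrr.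
  have pj : p (j z) = 0 by apply/jp; exists z.
  exists (y - j z); split; first by rewrite linearB py pj subr0.
  by rewrite linearB eP zP opprB addrC subrK.
Qed.

(** Shifts the complex by [n]. The degrees [n + m + 1] and [n + (m + 1)] are only provably equal, so
    [dd] transports the differentials, and its properties are proved for arbitrary equal indices. *)
Lemma gorenstein_cycles (E : int -> lmodType R)
    (d : forall n, {linear E n -> E (n + 1)}) (n : int) N (k : {linear N -> E n}) :
  (forall n, injective_mod (E n)) -> (forall n, exact_at (d n) (d (n + 1))) ->
  (forall J, strongly_fp_injective_mod J -> forall n, Hom_exact_mod J (d n) (d (n + 1))) ->
  injective k -> exact_at k (d n) -> gorenstein_strongly_fp_injective_mod N.
Proof.
move=> Einj dex dHom ki kd.
pose dd a b (e : a + 1 = b) : {linear E a -> E b} :=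
  eq_rect (a + 1) (fun b => {linear E a -> E b}) (d a) b e.
have ddE (m : int) : n + m + 1 = n + (m + 1) by rewrite addrA.
have ddex a b c (e : a + 1 = b) (e' : b + 1 = c) : exact_at (dd a b e) (dd b c e').
  by subst b c.
have ddHom J a b c (e : a + 1 = b) (e' : b + 1 = c) :
    strongly_fp_injective_mod J -> Hom_exact_mod J (dd a b e) (dd b c e').
  by subst b c; move=> HJ; apply: dHom.
have [k' [k'i k'd]] : exists k' : {linear N -> E (n + 0)},
    injective k' /\ exact_at k' (d (n + 0)) by rewrite addr0; exists k.
exists (fun m => E (n + m)), (fun m => dd (n + m) (n + (m + 1)) (ddE m)).
split=> [m|m|J HJ m|]; [exact: Einj|exact: ddex|exact: ddHom|].
by exists k'; split=> //; case: _ / (ddE 0).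
Qed.

(** The cokernel of [N] in the degree [0] term is the module of cycles in degree [1]; quantifying
    over [N'] admits any model of it. *)
Lemma gorenstein_embedding N :
  gorenstein_strongly_fp_injective_mod N ->
  exists (E : lmodType R) (k : {linear N -> E}),
  [/\ injective_mod E, injective k &
      forall N' (p : {linear E -> N'}), surj p -> exact_at k p ->
      gorenstein_strongly_fp_injective_mod N'].
Proof.
move=> [E [d [Einj dex dHom [k [ki kd]]]]]; exists (E 0), k; split=> // N' p ps kp.
have [m mP] := factor_surj (g := d 0) ps (fun x px => (kd x).2 ((kp x).1 px)).
apply: (gorenstein_cycles (n := 0 + 1) (k := m) Einj dex dHom).
  apply: inj_ker0 => c; have [x <-] := ps c.
  by rewrite mP => /kd /kp.
move=> y; rewrite (dex 0 y); split=> [[x <-]|[c <-]]; first by exists (p x).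
by have [x <-] := ps c; exists x.
Qed.

(** Dually, the kernel of the degree [-1] term onto [N] is the module of cycles in degree [-1]. *)
Lemma gorenstein_cover N :
  gorenstein_strongly_fp_injective_mod N ->
  exists (E : lmodType R) (p : {linear E -> N}),
  [/\ injective_mod E, surj p &
      forall N' (k : {linear N' -> E}), injective k -> exact_at k p ->
      gorenstein_strongly_fp_injective_mod N'].
Proof.
move=> [E [d [Einj dex dHom [k [ki kd]]]]].
have [p pP] := factor_inj (g := d (-1)) ki
  (fun x => (kd _).1 ((dex (-1) (d (-1) x)).2 (ex_intro _ x erefl))).
exists (E (-1)), p; split=> // [y|N' j ji jp].
  have /(dex (-1)) [x xP] : d 0 (k y) = 0 by apply/kd; exists y.
  by exists x; apply: ki; rewrite pP.
apply: (gorenstein_cycles (n := -1) (k := j) Einj dex dHom ji) => y.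
by rewrite -jp -pP; split=> [/(ker0_inj ki)|->]; rewrite ?linear0.
Qed.

End GorensteinModules.

(** * From Psi(GI) to Ding injective *)

Section PsiToDing.
Variables (Q : quiver) (R : pzRingType).
Hypotheses (rooted : right_rooted Q) (coh : kernels_fin_generated R).
Implicit Types X Y Z J : rep Q R.

(* Contains [Psi_GI], and unlike it is seen to be closed under the syzygies and
   cosyzygies below without knowing that extensions preserve Gorenstein
   modules. *)
Definition Psi_soc X := forall v : Q, surj (@psi Q R X v) /\
  gorenstein_strongly_fp_injective_mod (kermod (@psi Q R X v)).

(** At [v], lifting [u v] compatibly with the lifts at the targets means lifting through the pair of
    [g v] and [psi], whose kernel is the Gorenstein kernel of [psi] on [X]. *)
Lemma Psi_soc_lift X Y Z J (f : rep_hom X Y) (g : rep_hom Y Z) (u : rep_hom J Z) :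
  Psi_soc X -> (forall v, strongly_fp_injective_mod (J v)) -> short_exact f g ->
  exists w : rep_hom J Y, forall v x, g v (w v x) = u v x.
Proof.
move=> PX HJ [fm fg ge].
apply: (@rep_hom_rec Q rooted R J Y (fun v l => forall x, g v (l x) = u v x)) => v l lP.
have [ps pk] := PX v.
pose N := [the lmodType R of modprod (fun a : arrows_from v => Y (projT1 a))].
have phil : linear (fun y : Y v => (g v y, @psi Q R Y v y) : (Z v * N)%type).
  by move=> r x y; rewrite !linearP.
have mul : linear (fun x : J v => (u v x, fun a => l a (psi x a)) : (Z v * N)%type).
  move=> r x y; congr pair; first by rewrite linearP.
  apply: functional_extensionality_dep => a.
  by rewrite [psi _](linearP (@psi Q R J v)) -[X in l a X]/(r *: psi x a + psi y a) linearP.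
have [||x|w wP] := gorenstein_lift (j := f v \o @soc Q R X v)
  (p := mklin phil) (u := mklin mul) pk (HJ v).
- by move=> x y /fm /soc_inj.
- move=> y; split=> [[gy py]|[[x px] <-]].
    have /(fg v) [x xP] := gy; have px : psi x = 0.
      apply: functional_extensionality_dep => a; apply: fm.
      by rewrite -psi_nat xP py linear0.
    by have /soc_exact [z zP] := px; exists z; rewrite /= -xP -zP.
  congr pair; first by apply/fg; exists x.
  apply: functional_extensionality_dep => a; rewrite /= psi_nat.
  by rewrite (eqP px) linear0.
(* Pointwise solvability: a preimage of [u v x] is corrected by an element of [X v], found by
   surjectivity of [psi] on [X]. *)
- have [y0 y0P] := ge v (u v x).
  have h a : g (projT1 a) (psi y0 a - l a (psi x a)) = 0.
    by rewrite linearB lP -!psi_nat y0P subrr.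
  have [x' x'P] := dep_choice (fun a => (fg _ _).1 (h a)).
  have [x'' x''P] := ps x'; exists (y0 - f v x''); congr pair.
    by rewrite linearB y0P; have -> : g v (f v x'') = 0;
       [apply/fg; exists x'' | rewrite subr0].
  apply: functional_extensionality_dep => a.
  rewrite [psi _](linearB (@psi Q R Y v)) -[LHS]/(psi y0 a - psi (f v x'') a).
  by rewrite psi_nat x''P x'P opprB addrC subrK.
exists w => x => [|a]; first exact: (congr1 (fun t : (Z v * N)%type => t.1) (wP x)).
exact: (congr1 (fun t : (Z v * N)%type => t.2 a) (wP x)).
Qed.

(** Embeddings of the kernels of [psi] into the [E v] extend to the [X v]. As [psi] is surjective on
    [X], the snake lemma identifies the kernel of [psi] on [C] with the cokernel of [k v]. *)
Lemma Psi_soc_embedding X : Psi_soc X ->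
  exists C I (i : rep_hom X I) (p : rep_hom I C),
  [/\ Psi_soc C, injective_rep I & short_exact i p].
Proof.
move=> PX.
have [E /dep_choice [k kP]] := dep_choice (fun v => gorenstein_embedding (PX v).2).
have /dep_choice [e eP] v : exists e : {linear X v -> E v}, forall x, e (soc X v x) = k v x.
  by case: (kP v) => Einj _ _; apply: Einj; exact: soc_inj.
have ki v : injective (k v) by case: (kP v).
have im : rep_mono (to_cofree e).
  apply: to_cofree_mono => // v x /soc_exact [y <-]; rewrite eP.
  by move=> /(ker0_inj (@ki v)) ->; rewrite linear0.
have [C [p [pe ip]]] := rep_coker_exists (to_cofree e).
have Einj v : injective_mod (E v) by case: (kP v).
exists C, (cofree E), (to_cofree e), p; split=> //; last exact: injective_cofree.
move=> v; split.
  move=> y; have [z zP] := dep_choice (fun a : arrows_from v => pe _ (y a)).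
  have [t tP] := @psi_cofree_surj Q R E v z; exists (p v t).
  by apply: functional_extensionality_dep => a; rewrite psi_nat tP zP.
have p0 m : psi (p v (cofree_sub m)) = 0.
  by apply: functional_extensionality_dep => a; rewrite psi_nat psi_cofree_sub linear0.
have [q qP] := factor_inj (i := soc C v) (g := p v \o @cofree_sub Q R E v)
  (@soc_inj _ _ _ _) (fun m => (soc_exact _).1 (p0 m)).
case: (kP v) => _ _ /(_ _ q); apply.
  move=> c; have [y yP] := pe v (soc C v c).
  have h a : p (projT1 a) (psi y a) = 0.
    by rewrite -psi_nat yP; have -> : psi (soc C v c) = 0 by apply/soc_exact; exists c.
  have [x' x'P] := dep_choice (fun a => (ip _ _).1 (h a)).
  have [x xP] := (PX v).1 x'.
  have py : psi (y - to_cofree e v x) = 0.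
    apply: functional_extensionality_dep => a.
    rewrite [psi _](linearB (@psi Q R (cofree E) v)).
    by rewrite -[LHS]/(psi y a - psi (to_cofree e v x) a) psi_nat xP x'P subrr.
  exists ((y - to_cofree e v x) here); apply: soc_inj; rewrite qP /=.
  rewrite -(psi_cofree_eq0 py) linearB yP.
  by have -> : p v (to_cofree e v x) = 0; [apply/ip; exists x | rewrite subr0].
move=> m; have -> : (q m = 0) <-> p v (cofree_sub m) = 0.
  by rewrite -[p v _]/((p v \o @cofree_sub Q R E v) m) -qP;
     split=> [->|/(ker0_inj (@soc_inj _ _ _ _)) //]; rewrite linear0.
split=> [/(ip v) [x xm]|[x <-]].
  have /soc_exact [z zP] : psi x = 0.
    apply: functional_extensionality_dep => a; apply: im.
    by rewrite -psi_nat xm psi_cofree_sub linear0.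
  by exists z; rewrite -eP zP; exact: (congr1 (fun F : cofree_ob E v => F here) xm).
apply/ip; exists (soc X v x); rewrite -eP.
rewrite [LHS](psi_cofree_eq0 (v := v)) //; apply: functional_extensionality_dep => a.
rewrite psi_nat; have -> : psi (soc X v x) = 0 by apply/soc_exact; exists x.
by rewrite linear0.
Qed.

(** Dual construction: [h] is built from the sinks, with the cover [c v] prescribed on the kernel of
    [psi] on [cofree E]. *)
Lemma Psi_soc_cover X : Psi_soc X ->
  exists K I (k : rep_hom K I) (p : rep_hom I X),
  [/\ Psi_soc K, injective_rep I & short_exact k p].
Proof.
move=> PX.
have [E /dep_choice [c cP]] := dep_choice (fun v => gorenstein_cover (PX v).2).
have Einj v : injective_mod (E v) by case: (cP v).
have cs v : surj (c v) by case: (cP v).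
have [v l _|h hP] := @rep_hom_rec Q rooted R (cofree E) X
  (fun v l => forall m, l (cofree_sub m) = soc X v (c v m)).
  have [ps pk] := PX v.
  pose N a := cofree E (projT1 (a : arrows_from v)).
  pose lam := prod_pair (fun a : arrows_from v => l a \o prod_proj N a).
  (* The source of [lam] is a product of injectives, hence strongly fp-injective, so [lam] lifts
     through [psi], whose kernel is Gorenstein. *)
  have [||w wP] := gorenstein_lift (u := lam) pk _ (@soc_inj _ _ X v) (@soc_exact _ _ X v).
  - apply: (fp_injective_strongly coh); apply: injective_fp_injective.
    by apply: injective_modprod => a; apply: injective_modprod.
  - by move=> x; exact: ps.
  exists ((w \o @psi Q R (cofree E) v) \+ (soc X v \o (c v \o cofree_here E v))) => [m|x a].
    rewrite -[LHS]/(w (psi (cofree_sub m)) + soc X v (c v m)).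
    by rewrite psi_cofree_sub linear0 add0r.
  have e : psi (soc X v (c v (x here))) = 0 by apply/soc_exact; exists (c v (x here)).
  have -> : psi ((w \o @psi Q R (cofree E) v) x + soc X v (c v (x here))) = lam (psi x).
    by rewrite -[LHS]/(@psi Q R X v _) linearD [X in _ + X]e addr0 [LHS]wP.
  by [].
have hsurj : rep_epi h.
  move=> v; elim/(successor_ind rooted): v => v IH x.
  have [y yP] := dep_choice (fun a : arrows_from v => IH a (psi x a)).
  have [z zP] := @psi_cofree_surj Q R E v y.
  have /soc_exact [t tP] : psi (x - h v z) = 0.
    apply: functional_extensionality_dep => a; rewrite [psi _](linearB (@psi Q R X v)).
    by rewrite -[LHS]/(psi x a - psi (h v z) a) psi_nat zP yP subrr.
  have [m mP] := cs v t; exists (z + cofree_sub m).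
  by rewrite linearD hP mP tP addrC subrK.
have [K [k [km kh]]] := rep_ker_exists h.
exists K, (cofree E), k, h; split=> //; last exact: injective_cofree.
move=> v; split.
  move=> y; have [z zP] := @psi_cofree_surj Q R E v (fun a => k _ (y a)).
  have /soc_exact [t tP] : psi (h v z) = 0.
    apply: functional_extensionality_dep => a; rewrite psi_nat zP.
    by apply/kh; exists (y a).
  have [m mP] := cs v t.
  have /(kh v) [x xP] : h v (z - cofree_sub m) = 0 by rewrite linearB hP mP tP subrr.
  exists x; apply: functional_extensionality_dep => a; apply: km.
  have e : psi (z - cofree_sub m) = psi z.
    by rewrite -[LHS]/(@psi Q R (cofree E) v _) linearB [X in _ - X]psi_cofree_sub subr0.
  by rewrite -psi_nat xP e zP.
have kE x : k v (soc K v x) = cofree_sub (k v (soc K v x) here).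
  apply: psi_cofree_eq0; apply: functional_extensionality_dep => a; rewrite psi_nat.
  have -> : psi (soc K v x) = 0 by apply/soc_exact; exists x.
  exact: linear0.
case: (cP v) => _ _ /(_ _ (cofree_here E v \o (k v \o soc K v))); apply.
  move=> x y /= e; apply: (@soc_inj _ _ K v); apply: km.
  by rewrite kE [RHS]kE e.
move=> m; split=> [cm|[x <-]].
  have /(kh v) [x xP] : h v (cofree_sub m) = 0 by rewrite hP cm linear0.
  have /soc_exact [z zP] : psi x = 0.
    apply: functional_extensionality_dep => a; apply: km.
    by rewrite -psi_nat xP psi_cofree_sub linear0.
  by exists z; rewrite -[LHS]/(k v (soc K v z) here) zP xP.
apply: (@soc_inj _ _ X v); rewrite linear0 -hP.
rewrite -[X in h v X]/(cofree_sub (k v (soc K v x) here)) -kE.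
by apply/kh; exists (soc K v x).
Qed.

(** Cosyzygies and syzygies of [X] are spliced; [Psi_soc_lift] lifts maps from [J] into each cycle
    representation. *)
Lemma Psi_soc_gorenstein (P : rep Q R -> Prop) X :
  (forall J, P J -> forall v, strongly_fp_injective_mod (J v)) ->
  Psi_soc X -> gorenstein_rep P X.
Proof.
move=> PJ PX.
pose ses Y Z := exists I (i : rep_hom Y I) (p : rep_hom I Z),
  injective_rep I /\ short_exact i p.
have up (s : {Y | Psi_soc Y}) : {t : {Y | Psi_soc Y} | ses (sval s) (sval t)}.
  case: s => Y PY; apply: cid; have [C [I [i [p [PC II ip]]]]] := Psi_soc_embedding PY.
  by exists (exist _ C PC), I, i, p.
have down (s : {Y | Psi_soc Y}) : {t : {Y | Psi_soc Y} | ses (sval t) (sval s)}.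
  case: s => Y PY; apply: cid; have [K [I [k [p [PK II kp]]]]] := Psi_soc_cover PY.
  by exists (exist _ K PK), I, k, p.
pose U n := iter n (fun s => sval (up s)) (exist _ X PX).
pose D n := iter n (fun s => sval (down s)) (exist _ X PX).
pose T (n : int) : {Y | Psi_soc Y} := match n with Posz n => U n | Negz n => D n.+1 end.
have TP n : ses (sval (T n)) (sval (T (n + 1))).
  case: n => [n|[|n]].
  - by rewrite -PoszD addn1; exact: svalP (up (U n)).
  - exact: svalP (down (D 0%N)).
  - have -> : Negz n.+1 + 1 = Negz n by rewrite !NegzE -addn1 PoszD opprD subrK.
    exact: svalP (down (D n.+1)).
(* Shifted by one, since [X] must be the kernel in degree [1]. *)
have {}TP n : ses (sval (T (n - 1))) (sval (T (n + 1 - 1))) by rewrite addrAC; exact: TP.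
have [C /dep_choice [i /dep_choice [p ipP]]] := dep_choice TP.
pose Z n : rep Q R := sval (T (n - 1)).
have ipE n : injective_rep (C n) /\ @short_exact _ _ (Z n) _ (Z (n + 1)) (i n) (p n).
  exact: ipP.
have m n : rep_mono (i n) by case: (ipE n) => _ [].
have ex n : rep_exact (i n) (p n) by case: (ipE n) => _ [].
have ep n : rep_epi (p n) by case: (ipE n) => _ [].
pose d n : rep_hom (C n) (C (n + 1)) :=
  @rep_comp _ _ (C n) (Z (n + 1)) (C (n + 1)) (i (n + 1)) (p n).
have kd n v y : d n v y = 0 <-> exists x, i n v x = y.
  rewrite -(ex n v y); split=> [/(ker0_inj (@m (n + 1) v)) //|py].
  by rewrite /= py linear0.
exists C, d; split.
- by move=> n; case: (ipE n).
- move=> n v y; split=> [/kd [z <-]|[x <-]]; last by apply/kd; exists (p n v x).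
  by have [x <-] := ep n v z; exists x.
- move=> J /PJ HJ n u; split=> [du|[w wu] v x]; last first.
    by rewrite -wu; apply/kd; exists (p n v (w v x)).
  have [u' u'P] := rep_factor_mono (m (n + 1)) (fun v x => (kd _ v _).1 (du v x)).
  have [w wP] := Psi_soc_lift u' (svalP (T (n - 1))) HJ (ipE n).2.
  by exists w => v x; rewrite -u'P -wP.
- exists (i 1); split; first exact: m.
  by move=> v y; exact: kd.
Qed.

End PsiToDing.

(** * The cofree coresolution of a discrete representation *)

Section CofreeSequence.
Variables (Q : quiver) (R : pzRingType) (J : Q -> lmodType R).

Definition discrete_rep : rep Q R := Rep (fun i j (_ : arrow i j) =>
  (\0 : {linear J i -> J j})).

Fact discrete_cofree_nat (i j : Q) (a : arrow i j) (x : discrete_rep i) :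
  cofree_sub (rep_map discrete_rep a x) = rep_map (cofree J) a (cofree_sub x).
Proof. by rewrite [LHS]linear0. Qed.

Definition discrete_cofree : rep_hom discrete_rep (cofree J) :=
  @RepHom Q R discrete_rep (cofree J) (fun v => @cofree_sub Q R J v) discrete_cofree_nat.

Definition out_prod (v : Q) : lmodType R :=
  modprod (fun a : arrows_from v => J (projT1 a)).

(* A nonempty path is a path followed by its last arrow: on vertices, the
   sequence is [J v -> prod_(p from v) J (end p) -> prod_(p a from v) J (end a)]. *)
Definition cofree_last (v : Q) : {linear cofree J v -> out_prod v} :=
  prod_pair (fun a : arrows_from v =>
    prod_proj (fun p : path_from v => J (path_end p)) (step (projT2 a) here)).

Definition cofree_quotient : rep_hom (cofree J) (cofree out_prod) :=
  to_cofree cofree_last.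

Lemma discrete_cofree_exact : rep_exact discrete_cofree cofree_quotient.
Proof.
have ker (i : Q) (p : path_from i) : forall w (b : arrow w i) (x : cofree J w),
    cofree_quotient w x = 0 -> x (step b p) = 0.
  elim: p => {i} [i|i j c q IH] w b x x0.
    have := congr1 (fun F : cofree_ob out_prod w => F here) x0.
    by move=> /(congr1 (fun F : out_prod w => F (existT _ i b))).
  apply: (IH i c (rep_map (cofree J) b x)).
  by rewrite hom_nat x0 linear0.
move=> v x; split=> [x0|[y <-]].
  exists (x here); symmetry; apply: psi_cofree_eq0.
  apply: functional_extensionality_dep => -[j a].
  by apply: functional_extensionality_dep => q; exact: ker x0.
apply: functional_extensionality_dep => -[|j a q].
  exact: functional_extensionality_dep.
have -> : cofree_quotient v (discrete_cofree v y) (step a q) =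
  cofree_quotient j (rep_map (cofree J) a (discrete_cofree v y)) q by [].
by rewrite -discrete_cofree_nat [cofree_sub _]linear0 linear0.
Qed.

(** The value at [p] of a preimage of [z]: [m] is the component at the path read so far, replaced at
    each arrow. *)
Fixpoint glue_last (v : Q) (p : path_from v) :
    J v -> cofree out_prod v -> J (path_end p) :=
  match p with
  | here => fun m _ => m
  | step j a q => fun _ z =>
    @glue_last j q ((z here : out_prod v) (existT _ j a)) (rep_map (cofree out_prod) a z)
  end.

Lemma cofree_quotient_epi : rep_epi cofree_quotient.
Proof.
move=> v z; exists (fun p => glue_last p 0 z).
apply: functional_extensionality_dep => p.
elim: p (0 : J v) z => {v} [v|v j b q IH] m z; last exact: IH.
by apply: functional_extensionality_dep => -[w a].
Qed.

End CofreeSequence.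

(** * From Gorenstein strongly fp-injective to Psi(GI) *)

Section GorensteinToPsi.
Variables (Q : quiver) (R : pzRingType).
Hypotheses (rooted : right_rooted Q) (fin : locally_target_finite Q)
  (coh : kernels_fin_generated R).
Variables (C : int -> rep Q R) (d : forall n, rep_hom (C n) (C (n + 1))).
Hypotheses (Cinj : forall n, injective_rep (C n))
  (dex : forall n, rep_exact (d n) (d (n + 1)))
  (dHom : forall J, strongly_fp_injective_rep J ->
    forall n, Hom_exact J (d n) (d (n + 1))).

Let dd n v x : d (n + 1) v (d n v x) = 0.
Proof. by apply/dex; exists x. Qed.

(** Extend [u] to [u1] on [cofree J]. Then [d] after [u1] factors through the quotient as [z], which
    lifts to [y]; subtracting [y] from [u1] leaves a cycle that still restricts to [u] and lifts to
    [C n]. *)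
Lemma soc_lift (J : Q -> lmodType R) n (u : forall v, {linear J v -> C (n + 1) v}) :
  (forall v, fp_injective_mod (J v)) ->
  (forall v x, psi (u v x) = 0) -> (forall v x, d (n + 1) v (u v x) = 0) ->
  exists w : forall v, {linear J v -> C n v},
    forall v x, psi (w v x) = 0 /\ d n v (w v x) = u v x.
Proof.
move=> Jinj pu du.
have un (i j : Q) (a : arrow i j) (x : J i) :
    u j (rep_map (discrete_rep J) a x) = rep_map (C (n + 1)) a (u i x).
  rewrite linear0; symmetry.
  exact: (congr1 (fun F : modprod (fun b : arrows_from i => C (n + 1) (projT1 b)) =>
    F (existT _ j a)) (pu i x)).
pose U := @RepHom Q R (discrete_rep J) (C (n + 1)) u un.
have im : rep_mono (discrete_cofree J).
  by move=> v x y /(congr1 (fun F : cofree_ob J v => F here)).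
have [u1 u1P] := @Cinj (n + 1) _ _ _ U im.
have ker v x : cofree_quotient J v x = 0 -> d (n + 1) v (u1 v x) = 0.
  by move=> /discrete_cofree_exact [y <-]; rewrite u1P; exact: du.
have [z zP] := rep_factor_epi (g := rep_comp (d (n + 1)) u1)
  (@cofree_quotient_epi Q R J) ker.
have Jsfp : strongly_fp_injective_rep (cofree J) by exact: strongly_fp_injective_cofree.
have Nsfp : strongly_fp_injective_rep (cofree (out_prod J)).
  by apply: strongly_fp_injective_cofree => // v; apply: fp_injective_modprod.
have [y yP] : exists y : rep_hom (cofree (out_prod J)) (C (n + 1)),
    forall v x, d (n + 1) v (y v x) = z v x.
  apply: (dHom Nsfp z).1 => v t; have [x <-] := @cofree_quotient_epi Q R J v t.
  by rewrite zP dd.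
have [w wP] : exists w : rep_hom (cofree J) (C n), forall v x, d n v (w v x) =
    rep_sub u1 (rep_comp y (cofree_quotient J)) v x.
  apply: (dHom Jsfp _).1 => v x; rewrite linearB.
  by rewrite [X in _ - X]yP zP subrr.
exists (fun v => w v \o @cofree_sub Q R J v) => v x; split.
  apply: functional_extensionality_dep => a.
  by rewrite psi_nat psi_cofree_sub linear0.
have e : cofree_quotient J v (discrete_cofree J v x) = 0.
  by apply/discrete_cofree_exact; exists x.
rewrite [LHS]wP -[LHS]/(u1 v (discrete_cofree J v x) -
  y v (cofree_quotient J v (discrete_cofree J v x))) u1P e.
by rewrite linear0 subr0.
Qed.

(** The family is completed by zero maps. *)
Lemma soc_lift_at (J : lmodType R) n v (u : {linear J -> C (n + 1) v}) :
  fp_injective_mod J -> (forall x, psi (u x) = 0) -> (forall x, d (n + 1) v (u x) = 0) ->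
  exists w : {linear J -> C n v}, forall x, psi (w x) = 0 /\ d n v (w x) = u x.
Proof.
move=> Jinj pu du.
pose T w := {t : {linear J -> C (n + 1) w} |
  (forall x, psi (t x) = 0) /\ (forall x, d (n + 1) w (t x) = 0)}.
have t0 w : T w.
  by exists \0; split=> x; exact: linear0.
have [t tv] := dfun_update t0 (exist _ u (conj pu du) : T v).
have [w wP] := soc_lift (J := fun _ => J) (u := fun w => sval (t w)) (fun _ => Jinj)
  (fun w => (svalP (t w)).1) (fun w => (svalP (t w)).2).
by exists (w v) => x; have := wP v x; rewrite tv.
Qed.

(** Lift [psi] of [u] at the targets, pull the lifts back through the split surjection [psi], and
    treat the remainder, which [psi] kills, by [soc_lift_at]. *)
Lemma vertex_lift (J : lmodType R) : fp_injective_mod J ->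
  forall v n (u : {linear J -> C (n + 1) v}), (forall x, d (n + 1) v (u x) = 0) ->
  exists w : {linear J -> C n v}, forall x, d n v (w x) = u x.
Proof.
move=> Jinj; apply: (successor_ind rooted) => v IH n u du.
have /dep_choice [e eP] a : exists e : {linear J -> C n (projT1 a)},
    forall x, d n (projT1 a) (e x) = psi (u x) a.
  apply: (IH a n (prod_proj (fun a : arrows_from v => C (n + 1) (projT1 a)) a
    \o (@psi Q R (C (n + 1)) v \o u))) => x.
  by rewrite /= -psi_nat du linear0.
have [e' e'P] := split_injective_kernel (prod_pair e)
  (injective_rep_surj (v := v) rooted (@Cinj n)) (injective_rep_soc rooted (@Cinj n)).
have [||w wP] := soc_lift_at (u := u \- (d n v \o e')) Jinj.
- move=> x; apply: functional_extensionality_dep => a.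
  have -> : psi ((u \- (d n v \o e')) x) a = psi (u x) a - psi (d n v (e' x)) a.
    exact: (linearB (rep_map (C (n + 1)) (projT2 a))).
  by rewrite [X in _ - X]psi_nat e'P -eP subrr.
- by move=> x; rewrite /= linearB du dd subrr.
by exists (e' \+ w) => x; rewrite /= linearD (wP x).2 /= [LHS]addrC subrK.
Qed.

Variables (X : rep Q R) (k : rep_hom X (C 1)).
Hypothesis kP : is_kernel k (d 1).

(** [X v] and the kernel of [psi] on it are the cycles in degree [1] of the complexes of the [C n v]
    and of the kernels of [psi] on them. *)
Lemma gorenstein_Psi : Psi_GI X.
Proof.
have [km ke] := kP => v; split.
- move=> y; have h a : d (0 + 1) _ (k (projT1 a) (y a)) = 0 by apply/ke; exists (y a).
  have [c cP] := dep_choice (fun a => (dex _).1 (h a)).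
  have [c' c'P] := injective_rep_surj (v := v) rooted (@Cinj 0) c.
  have /ke [x xP] : d 1 v (d 0 v c') = 0 by exact: (@dd 0 v c').
  exists x; apply: functional_extensionality_dep => a; apply: km.
  by rewrite -psi_nat xP -cP psi_nat c'P.
- apply: (gorenstein_cycles (E := fun n => C n v) (d := fun n => d n v) (n := 1) (k := k v)).
  + by move=> n; apply: injective_rep_at.
  + by move=> n; exact: dex.
  + move=> J HJ n u; split=> [|[w wu] x]; last by rewrite -wu dd.
    by apply: vertex_lift; apply: strongly_fp_injective.
  + exact: km.
  + exact: ke.
- have dS n x : psi ((d n v \o soc (C n) v) x) = 0.
    apply: functional_extensionality_dep => a; rewrite psi_nat.
    have -> : psi (soc (C n) v x) = 0 by apply/soc_exact; exists x.
    exact: linear0.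
  have [D DP] := dep_choice (fun n => factor_inj (@soc_inj Q R (C (n + 1)) v)
    (fun x => (soc_exact _).1 (dS n x))).
  have kS x : psi ((k v \o soc X v) x) = 0.
    apply: functional_extensionality_dep => a; rewrite psi_nat.
    have -> : psi (soc X v x) = 0 by apply/soc_exact; exists x.
    exact: linear0.
  have [l lP] := factor_inj (@soc_inj Q R (C 1) v) (fun x => (soc_exact _).1 (kS x)).
  apply: (gorenstein_cycles (E := fun n => kermod (@psi Q R (C n) v)) (d := D)
     (n := 1) (k := l)).
  + by move=> n; apply: injective_rep_soc.
  + move=> n y; split=> [Dy|[x <-]]; last first.
      by apply: soc_inj; rewrite DP -[LHS]/(d _ v (soc _ v (D n x))) DP linear0; exact: dd.
    (* A preimage [c] of [y] in degree [n] must be corrected by a boundary to be killed by [psi];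
       writing [n] as [m + 1] makes degree [m] available. *)
    have [m nm] : exists m, n = m + 1 by exists (n - 1); rewrite subrK.
    subst n.
    have /dex [c cP] : d (m + 1 + 1) v (soc _ v y) = 0.
      by have := DP (m + 1 + 1) y; rewrite Dy linear0 => /esym.
    have h a : d (m + 1) (projT1 a) (psi c a) = 0.
      by rewrite -psi_nat cP; have -> : psi (soc _ v y) = 0 by apply/soc_exact; exists y.
    have [e eP] := dep_choice (fun a => (dex _).1 (h a)).
    have [e' e'P] := injective_rep_surj (v := v) rooted (@Cinj m) e.
    have /soc_exact [x xP] : psi (c - d m v e') = 0.
      apply: functional_extensionality_dep => a.
      have -> : psi (c - d m v e') a = psi c a - psi (d m v e') a.
        exact: (linearB (rep_map (C (m + 1)) (projT2 a))).
      by rewrite [X in _ - X]psi_nat e'P eP subrr.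
    exists x; apply: soc_inj; rewrite DP -[LHS]/(d (m + 1) v (soc _ v x)) xP.
    by rewrite linearB dd subr0.
  + move=> J HJ n u; split=> [Du|[w wu] x]; last first.
      apply: soc_inj; rewrite -wu DP -[LHS]/(d _ v (soc _ v (D n (w x)))) DP linear0.
      exact: dd.
    have [|||w wP] := @soc_lift_at J n v (soc _ v \o u).
    * exact: strongly_fp_injective.
    * by move=> x; apply/soc_exact; exists (u x).
    * by move=> x; have := DP (n + 1) (u x); rewrite Du linear0 => /esym.
    have [w' w'P] := factor_inj (@soc_inj Q R (C n) v) (fun x => (soc_exact _).1 (wP x).1).
    exists w' => x; apply: soc_inj; rewrite DP -[LHS]/(d n v (soc _ v (w' x))) w'P.
    exact: (wP x).2.
  + move=> x y e; apply: soc_inj; apply: km.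
    by have := lP x; rewrite e lP.
  + move=> y; split=> [Dy|[x <-]].
      have /ke [x xP] : d 1 v (soc _ v y) = 0.
        by have := DP 1 y; rewrite Dy linear0 => /esym.
      have /soc_exact [z zP] : psi x = 0.
        apply: functional_extensionality_dep => a; apply: km.
        rewrite -psi_nat xP; have -> : psi (soc _ v y) = 0 by apply/soc_exact; exists y.
        by rewrite linear0.
      by exists z; apply: soc_inj; rewrite lP -[LHS]/(k v (soc _ v z)) zP xP.
    apply: soc_inj; rewrite DP -[LHS]/(d 1 v (soc _ v (l x))) lP linear0.
    by apply/ke; exists (soc X v x).
Qed.

End GorensteinToPsi.

Theorem corollary4p8 (Q : quiver) (R : pzRingType)
    (HQfin : locally_target_finite Q) (HQrooted : right_rooted Q)
    (HR : left_coherent R) (X : rep Q R) :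
  (ding_injective_rep X <-> gorenstein_strongly_fp_injective_rep X) /\
  (gorenstein_strongly_fp_injective_rep X <-> Psi_GI X).
Proof.
have coh := coherent_kernels HR.
have fp_at (J : rep Q R) : fp_injective_rep J -> forall v, strongly_fp_injective_mod (J v).
  by move=> HJ v; apply: (fp_injective_strongly coh); exact: fp_injective_rep_at.
have Psi_ding : Psi_GI X -> ding_injective_rep X.
  move=> PX; apply: (Psi_soc_gorenstein HQrooted coh fp_at).
  by move=> v; have [ps _ pk] := PX v.
have ding_gor : ding_injective_rep X -> gorenstein_strongly_fp_injective_rep X.
  move=> [C [d [Cinj dex dHom kP]]]; exists C, d; split=> // J HJ.
  by apply: dHom; exact: strongly_fp_injective_rep_fp.
have gor_Psi : gorenstein_strongly_fp_injective_rep X -> Psi_GI X.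
  move=> [C [d [Cinj dex dHom [k kP]]]].
  exact: (gorenstein_Psi HQrooted HQfin coh Cinj dex dHom kP).
split; split=> //; first by move=> /gor_Psi.
by move=> /Psi_ding.
Qed.
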